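(* Let $T=[0,t_1]$ with $0<t_1<\infty$, let $U\subset\mathbb{R}^p$, and let $f:T\times\mathbb{R}^n\times U\to\mathbb{R}^n$, $L_r:T\times\mathbb{R}^n\times U\to\mathbb{R}$, $L_{mx}:T\times\mathbb{R}^n\to\mathbb{R}$, $\Psi:\mathbb{R}^n\to\mathbb{R}$. Assume: (A.0) $U$ is compact. (A.1) $f$ is continuous and there is $K_f>0$ such that for all $(s,u)\in T\times U$: $|f(s,x,u)-f(s,x',u)|\le K_f|x-x'|$ for all $x,x'\in\mathbb{R}^n$, and $|f(s,x,u)|\le K_f(1+|x|)$ for all $x\in\mathbb{R}^n$. (A.2) $L_r$, $L_{mx}$ and $\Psi$ are continuous, and there is $K_L<\infty$ such that $|L_{mx}(s,x)-L_{mx}(s,x')|\le K_L|x-x'|$ for all $s\in T$, $x,x'\in\mathbb{R}^n$. (A.5) There is $K_r>0$ such that for all $(s,u)\in T\times U$: $|L_r(s,x,u)-L_r(s,x',u)|\le K_r|x-x'|$ for all $x,x'\in\mathbb{R}^n$, and $|L_r(s,x,u)|\le K_r(1+|x|)$ for all $x\in\mathbb{R}^n$. Then: (a) If relaxed controls $\boldsymbol\sigma_n\in\mathcal{S}$ converge r-weakly to $\boldsymbol\sigma\in\mathcal{S}$ and initial conditions $x_{0n}\to x_0$ in a compact set $\mathcal{I}\subset\mathbb{R}^n$, then (i) $\displaystyle\int_0^{t_1}L_r\big(t,x_{\boldsymbol\sigma_n,x_{0n}}(t),\sigma_n(t)\big)\,dt\longrightarrow\int_0^{t_1}L_r\big(t,x_{\boldsymbol\sigma,x_0}(t),\sigma(t)\big)\,dt$,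 and (ii) $\big\|\boldsymbol y_{\boldsymbol\sigma_n,x_{0n}}-\boldsymbol y_{\boldsymbol\sigma,x_0}\big\|_\infty\longrightarrow 0$. (b) Moreover, for the given initial condition $x_0$ there exists an optimal relaxed control, i.e. some $\boldsymbol\sigma^*\in\mathcal{S}$ attaining $$\sup_{\boldsymbol\sigma\in\mathcal{S}}J(x_0;\boldsymbol\sigma),\qquad J(x_0;\boldsymbol\sigma)=\int_0^{t_1}L_r\big(t,x_{\boldsymbol\sigma,x_0}(t),\sigma(t)\big)\,dt+\Psi\big(x_{\boldsymbol\sigma,x_0}(t_1)\big)-\sup_{t\in T}L_{mx}\big(t,x_{\boldsymbol\sigma,x_0}(t)\big).$$
   Context: $|\cdot|$ is the Euclidean norm and $\|\cdot\|_\infty$ the supremum norm over $T$. $\mathcal{P}(U)$ is the space of (Borel) probability measures on $U$ with the topology of weak convergence. A relaxed control is a Lebesgue measurable map $\boldsymbol\sigma:T\to\mathcal{P}(U)$, $t\mapsto\sigma(t)=\sigma(t,\cdot)$; $\mathcal{S}$ is the set of all relaxed controls. r-weak convergence: $\boldsymbol\sigma_k\to\boldsymbol\sigma$ r-weakly if $\int_0^{t_1}\int_U g(t,u)\,\sigma_k(t,du)\,dt\to\int_0^{t_1}\int_U g(t,u)\,\sigma(t,du)\,dt$ for every $g:T\times U\to\mathbb{R}$ that is measurable in $t$, continuous in $u$ and satisfies $\int_0^{t_1}\sup_{u\in U}|g(t,u)|\,dt<\infty$. For a relaxed control, write $f(t,x,\sigma(t)):=\int_U f(t,x,u)\,\sigma(t,du)$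 and $L_r(t,x,\sigma(t)):=\int_U L_r(t,x,u)\,\sigma(t,du)$. For $\boldsymbol\sigma\in\mathcal{S}$ and $x_0\in\mathbb{R}^n$, the relaxed trajectory $\boldsymbol x_{\boldsymbol\sigma,x_0}=(x_{\boldsymbol\sigma,x_0}(t),t\in T)$ is the unique solution of $\dot x(s)=f(s,x(s),\sigma(s))$ for (almost every) $s\in T$, $x(0)=x_0$ (in integral form). The max-trajectory $\boldsymbol y_{\boldsymbol\sigma,x_0}$ is $y_{\boldsymbol\sigma,x_0}(t):=\sup_{s\in[0,t]}L_{mx}(s,x_{\boldsymbol\sigma,x_0}(s))$, $t\in T$. *)

(* Defs.v *)
From mathcomp Require Export all_boot all_order all_algebra.
From mathcomp Require Export all_classical all_reals all_analysis.
Set Implicit Arguments.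
Unset Strict Implicit.
Unset Printing Implicit Defensive.
Export Order.TTheory GRing.Theory Num.Theory.
Export numFieldNormedType.Exports.

#[global] Open Scope classical_set_scope.
#[global] Open Scope ring_scope.

(* The topology of 'rV[R]_n is the library's (sup-norm) one, which is also the
   topology of the Euclidean norm; the norm itself is only used in the
   Lipschitz and growth bounds. *)
Definition enorm (R : realType) (n : nat) (x : 'rV[R]_n) : R :=
  Num.sqrt (\sum_(i < n) x ord0 i ^+ 2).

Definition horizon (R : realType) (t : R) : set R := `[0, t]%classic.

(* The real line with the Lebesgue (Caratheodory, complete) sigma-algebra, which
   is strictly larger than the Borel sigma-algebra carried by R itself. *)
Notation lebesgueR R := (caratheodory_type ((wlength (@idfun R))^*)%mu).
Notation leb R := (@completed_lebesgue_measure R).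

Notation borelRV R p := (g_sigma_algebraType (@open 'rV[R]_p)).

Section RelaxedControls.
Context {R : realType} {p : nat}.
Implicit Types (U : set 'rV[R]_p).

(* A Borel probability measure on a (Borel) set U is encoded as a Borel
   probability measure on R^p giving mass 1 to U. *)
Definition proba_on U : set (probability (borelRV R p) R) :=
  [set P | P U = 1%E].

Definition test_fun U : set ('rV[R]_p -> R) :=
  [set phi | {within U, continuous phi} /\
             exists M : R, forall u, U u -> `|phi u| <= M].

Definition test_eval U (P : proba_on U) : {ptws test_fun U -> R} :=
  fun phi => \int[\val P]_(u in U) (\val phi) u.

(* P(U) with the topology of weak convergence: the coarsest one that makes
   P |-> \int_U phi dP continuous for every bounded continuous phi on U. *)
Definition PU U := initial_topology (@test_eval U).

Definition proba_of U (P : PU U) : probability (borelRV R p) R :=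
  \val (P : proba_on U).

Definition avg U (P : PU U) (h : 'rV[R]_p -> R) : R :=
  \int[proba_of P]_(u in U) h u.

(* Only the values of sigma on [0, t1] matter. *)
Definition relaxed_controls (t1 : R) U : set (R -> PU U) :=
  [set sigma | forall B : set (PU U), <<s @open (PU U) >> B ->
     measurable (horizon t1 `&` sigma @^-1` B : set (lebesgueR R))].

Definition rweak_cvg (t1 : R) U (sigma_ : nat -> R -> PU U)
    (sigma : R -> PU U) : Prop :=
  forall g : R -> 'rV[R]_p -> R,
    (forall u, U u ->
       measurable_fun (horizon t1 : set (lebesgueR R))
         (fun t : lebesgueR R => g t u)) ->
    (forall t, horizon t1 t -> {within U, continuous (g t)}) ->
    (\int[leb R]_(t in horizon t1)
       ereal_sup [set `|g t u|%:E | u in U] < +oo)%E ->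
    (fun k => \int[leb R]_(t in horizon t1) avg (sigma_ k t) (g t))
      @ \oo --> \int[leb R]_(t in horizon t1) avg (sigma t) (g t).

Section Dynamics.
Context {n : nat}.
Implicit Types (f : R -> 'rV[R]_n -> 'rV[R]_p -> 'rV[R]_n)
  (L : R -> 'rV[R]_n -> 'rV[R]_p -> R) (Lmx : R -> 'rV[R]_n -> R)
  (Psi : 'rV[R]_n -> R).

Definition relaxed_field U f (s : R) (z : 'rV[R]_n) (P : PU U) : 'rV[R]_n :=
  \row_(i < n) avg P (fun u => f s z u ord0 i).

(* Integral form of x'(s) = f(s, x(s), sigma(s)) for a.e. s in [0, t1],
   x(0) = x0; vector integrals are taken coordinatewise. Integrability is
   explicit because the real-valued integral is total. *)
Definition is_trajectory (t1 : R) U f (sigma : R -> PU U)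
    (x0 : 'rV[R]_n) (x : R -> 'rV[R]_n) : Prop :=
  {within horizon t1, continuous x} /\
  forall i : 'I_n,
    (leb R).-integrable (horizon t1)
      (fun s => (relaxed_field f s (x s) (sigma s) ord0 i)%:E) /\
    forall t, horizon t1 t ->
      x t ord0 i = x0 ord0 i +
        \int[leb R]_(s in horizon t)
          relaxed_field f s (x s) (sigma s) ord0 i.

(* The solution is unique on [0, t1] only: the values picked outside [0, t1]
   are irrelevant. The default value is used only when there is no solution. *)
Definition trajectory (t1 : R) U f (sigma : R -> PU U)
    (x0 : 'rV[R]_n) : R -> 'rV[R]_n :=
  xget (fun=> 0) [set x | is_trajectory t1 f sigma x0 x].

Definition running_cost (t1 : R) U f L (sigma : R -> PU U)
    (x0 : 'rV[R]_n) : R :=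
  \int[leb R]_(t in horizon t1)
    avg (sigma t) (L t (trajectory t1 f sigma x0 t)).

Definition max_trajectory (t1 : R) U f Lmx (sigma : R -> PU U)
    (x0 : 'rV[R]_n) (t : R) : R :=
  sup [set Lmx s (trajectory t1 f sigma x0 s) | s in horizon t].

Definition payoff (t1 : R) U f L Lmx Psi (x0 : 'rV[R]_n)
    (sigma : R -> PU U) : R :=
  running_cost t1 f L sigma x0 + Psi (trajectory t1 f sigma x0 t1)
  - sup [set Lmx t (trajectory t1 f sigma x0 t) | t in horizon t1].

End Dynamics.
End RelaxedControls.

Definition supnorm (R : realType) (t1 : R) (h : R -> R) : \bar R :=
  ereal_sup [set `|h t|%:E | t in horizon t1].

(* Main.v *)
Require Import Defs.
From HB Require Import structures.
From mathcomp Require Import measurable_realfun ring lra.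

(** Two facts carry the proof: the data of the problem depend continuously on
    the control, and the set of relaxed controls is compact. Both are stated for
    convergence along an arbitrary filter on the integers, tested only on the
    products of the indicator of a Borel set of times with a continuous function
    on U ([control_cvg]). The same continuity statement then serves the sequences
    of part (a) and the ultrafilter of part (b).

    _Continuity._ Along a continuous path x the integrand [f s (x s) u] is
    continuous in s uniformly in u, because U is compact; it is therefore
    uniformly approximated by step functions of time with values in C(U), and
    [control_cvg] extends to it ([control_cvg_time]). Applied to the limit
    trajectory this shows that the right-hand side of the state equation of the
    k-th control, evaluated on the limit trajectory, has primitives that converge
    pointwise; they are equi-Lipschitz, so they converge uniformly
    ([velocity_integral_cvg]). The Lipschitz condition on f turns this into
    uniform convergence of the trajectories: in the norm weighted by
    [expR (2 * K * t)] the integral operator of the state equation is a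
    contraction of factor 1/2, which yields existence by Picard iteration
    ([trajectory_exists]) and replaces the Gronwall inequality for stability
    ([weighted_gronwall], [trajectory_cvg]). The convergence of the running cost,
    of the max-trajectory and of the payoff follows from the Lipschitz bounds on
    the costs and the continuity of Psi. The bounds are given for the Euclidean norm and used for the
    maximum norm of the coordinates, at the price of a factor [sqrt n].

    _Compactness._ Let F be an ultrafilter on the integers that refines the
    convergence to infinity. For phi in C(U) the bounded numbers
    [\int_A avg (sigma_k t) phi dt] have a limit along F, which is additive in A
    and dominated by a multiple of Lebesgue measure, hence absolutely continuous
    with a density. By Lebesgue differentiation this density is almost everywhere
    the limit of the difference quotients of the charge, and the limit of these
    quotients along F exists at every t and for every phi at once. For each
    [t < t1] it is a positive normalized linear functional of phi, so the Riesz
    representation theorem ([riesz_representation]) provides the value at t of a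
    limit control; no exceptional set of times depending on phi has to be
    removed. The limit control is measurable because the weak topology on the
    probability measures has a countable base made of conditions on finitely many
    averages of functions of a countable dense family ([weak_box_base],
    [relaxed_controls_avg]).

    An optimal control is then the limit, along such an ultrafilter, of a sequence
    of controls whose payoffs tend to the supremum. *)

Set Implicit Arguments.
Unset Strict Implicit.
Unset Printing Implicit Defensive.

(** * Integrals of bounded functions; Lebesgue versus Borel measurability *)

Section RealIntegrals.
Context d {T : measurableType d} {R : realType} (mu : {measure set T -> \bar R}).

Lemma bounded_integrable (A : set T) (h : T -> R) (M : R) :
  measurable A -> (mu A < +oo)%E -> measurable_fun A h ->
  (forall x, A x -> `|h x| <= M) -> mu.-integrable A (EFin \o h).
Proof.
move=> mA muA mh hM; apply: measurable_bounded_integrable => //.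
exists M; split; first exact: num_real.
by move=> N MN x Ax; apply: le_trans (hM x Ax) (ltW MN).
Qed.

Lemma normr_Rintegral_le (A : set T) (h : T -> R) (M : R) :
  measurable A -> (mu A < +oo)%E -> measurable_fun A h ->
  (forall x, A x -> `|h x| <= M) ->
  `|\int[mu]_(x in A) h x| <= M * fine (mu A).
Proof.
move=> mA muA mh hM.
have ih := bounded_integrable mA muA mh hM.
rewrite (le_trans (le_normr_Rintegral mA ih))// -Rintegral_cst//.
apply: le_Rintegral => //.
- apply: (bounded_integrable (M := M)) => //; first exact: measurableT_comp.
  by move=> x Ax; rewrite normr_id hM.
- by apply: (bounded_integrable (M := `|M|)).
Qed.

Lemma Rintegral_indic_restr (A B : set T) (h : T -> R) :
  \int[mu]_(x in A) (\1_B x * h x) = \int[mu]_(x in A `&` B) h x.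
Proof.
rewrite Rintegral_mkcondr; apply: eq_Rintegral => x _.
by rewrite patchE indicE; case: ifPn => _; rewrite ?mul1r ?mul0r.
Qed.

Lemma integrable_Rsum (I : Type) (r : seq I) (A : set T) (h : I -> T -> R) :
  measurable A -> (forall i, mu.-integrable A (EFin \o h i)) ->
  mu.-integrable A (EFin \o (fun x => \sum_(i <- r) h i x)).
Proof.
move=> mA ih; rewrite (_ : EFin \o _ = fun x => \sum_(i <- r) (EFin \o h i) x)%E.
  exact: integrable_sum.
by apply/funext => x /=; rewrite sumEFin.
Qed.

Lemma Rintegral_sum (I : Type) (r : seq I) (A : set T) (h : I -> T -> R) :
  measurable A -> (forall i, mu.-integrable A (EFin \o h i)) ->
  \int[mu]_(x in A) (\sum_(i <- r) h i x) = \sum_(i <- r) \int[mu]_(x in A) h i x.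
Proof.
move=> mA ih; elim: r => [|i r IH].
  rewrite big_nil; under eq_Rintegral do rewrite big_nil.
  by rewrite Rintegral_cst// mul0r.
rewrite big_cons -IH -RintegralD//.
  by apply: eq_Rintegral => x _; rewrite big_cons.
exact: integrable_Rsum.
Qed.

End RealIntegrals.

Section LebesgueBorel.
Context {R : realType}.
Implicit Types (A : set R) (h : R -> R).

Lemma measurable_lebesgueR A :
  measurable (A : set R) -> measurable (A : set (lebesgueR R)).
Proof. exact: sub_caratheodory. Qed.

Lemma measurable_fun_lebesgueR d (T : measurableType d) A (h : R -> T) :
  measurable (A : set R) ->
  measurable_fun (A : set R) h ->
  measurable_fun (A : set (lebesgueR R)) (h : lebesgueR R -> T).
Proof. by move=> mA mh _ B mB; apply: measurable_lebesgueR; exact: mh. Qed.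

(** The completed measure extends the Borel one, and the identity from the
    complete to the Borel sigma-algebra pushes the former onto the latter. *)
Lemma integral_lebesgueR A (g : R -> \bar R) :
  measurable (A : set R) ->
  measurable_fun (A : set R) g ->
  (\int[leb R]_(x in A) g x = \int[lebesgue_measure]_(x in A) g x)%E.
Proof.
move=> mA mg.
pose idR : lebesgueR R -> measurableTypeR R := idfun.
have midR : measurable_fun setT idR.
  by move=> _ B mB; rewrite setTI; apply: measurable_lebesgueR.
have ge0E (f : R -> \bar R) : measurable_fun (A : set R) f ->
    (forall x, 0 <= f x)%E ->
    (\int[leb R]_(x in A) f x = \int[lebesgue_measure]_(x in A) f x)%E.
  move=> mf f0; rewrite -[LHS](@ge0_integral_pushforward _ _ _ _ _ idR midR)//.
rewrite integralE [RHS]integralE !ge0E//.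
- exact: measurable_funeneg.
- exact: measurable_funepos.
Qed.

Lemma Rintegral_lebesgueR A h :
  measurable (A : set R) ->
  measurable_fun (A : set R) h ->
  \int[leb R]_(x in A) h x = \int[lebesgue_measure]_(x in A) h x.
Proof.
by move=> mA mh; rewrite /Rintegral integral_lebesgueR//; exact/measurable_EFinP.
Qed.

Lemma measurable_horizon (t : R) : measurable (horizon t : set (lebesgueR R)).
Proof. by apply: measurable_lebesgueR; exact: measurable_itv. Qed.

Lemma leb_horizon (t : R) : 0 <= t -> leb R (horizon t) = t%:E.
Proof.
move=> t0; rewrite [LHS](_ : _ = lebesgue_measure (horizon t))//.
rewrite /horizon lebesgue_measure_itv/= lte_fin.
by case: ltgtP t0 => // [|<-]; rewrite ?oppr0 ?adde0 -?EFinB ?subr0.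
Qed.

Lemma horizon_sub (s t : R) : s <= t -> horizon s `<=` horizon t.
Proof.
by move=> st x; rewrite /horizon /= !in_itv/= => /andP[-> /le_trans->].
Qed.

Lemma leb_horizon_lty (t : R) : (leb R (horizon t) < +oo)%E.
Proof.
have [t0|t0] := leP 0 t; first by rewrite leb_horizon// ltry.
rewrite /horizon set_itv_ge ?measure0//.
by rewrite bnd_simp -ltNge.
Qed.

End LebesgueBorel.

(** * Averages over the control set *)

Section WithinContinuity.
Context {T : topologicalType} {R : realType} (A : set T).
Implicit Types f g : T -> R.

Lemma within_continuous_cst (c : R) : {within A, continuous (fun=> c : R)}.
Proof. by apply: continuous_subspaceT => x; exact: cvg_cst. Qed.

Lemma within_continuousM f g : {within A, continuous f} ->
  {within A, continuous g} -> {within A, continuous (fun x => f x * g x)}.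
Proof. by move=> cf cg x; apply: cvgM; [exact: cf|exact: cg]. Qed.

Lemma within_continuous_min f g : {within A, continuous f} ->
  {within A, continuous g} -> {within A, continuous (fun x => Num.min (f x) (g x))}.
Proof.
move=> cf cg x; apply: (@continuous_min R (subspace A) f g x).
  exact: cf.
exact: cg.
Qed.

Lemma within_continuousZ (c : R) f : {within A, continuous f} ->
  {within A, continuous (fun x => c * f x)}.
Proof. exact/within_continuousM/within_continuous_cst. Qed.

Lemma within_continuous_sum (I : Type) (r : seq I) (f : I -> T -> R) :
  (forall i, {within A, continuous (f i)}) ->
  {within A, continuous (fun x => \sum_(i <- r) f i x)}.
Proof.
move=> cf; elim: r => [|i r IH].
  by rewrite (_ : (fun x => _) = fun=> 0);
    [exact: within_continuous_cst|apply/funext => x; rewrite big_nil].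
rewrite (_ : (fun x => _) = fun x => f i x + \sum_(j <- r) f j x).
  exact: within_continuousD.
by apply/funext => x; rewrite big_cons.
Qed.

End WithinContinuity.

Section Averages.
Context {R : realType} {p : nat} {U : set 'rV[R]_p}.
Hypothesis U_compact : compact U.
Implicit Types (phi psi : 'rV[R]_p -> R) (P : PU U).

Lemma measurable_borelRV_closed (A : set 'rV[R]_p) :
  closed A -> measurable (A : set (borelRV R p)).
Proof.
move=> cA; rewrite -[A]setCK; apply: measurableC.
by apply: sub_sigma_algebra; rewrite /= openC.
Qed.

Let U_closed : closed U.
Proof. by apply: compact_closed => //; exact: norm_hausdorff. Qed.

Lemma measurable_control_set : measurable (U : set (borelRV R p)).
Proof. exact: measurable_borelRV_closed. Qed.

Lemma measurable_fun_control_set phi : {within U, continuous phi} ->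
  measurable_fun (U : set (borelRV R p)) (phi : borelRV R p -> R).
Proof.
move/continuousP => cphi; apply: (measurability _ (RGenOpens.measurableE R)).
move=> _ [_ [a [b ->] <-]].
have : open (from_subspace U phi @^-1` `]a, b[%classic).
  by apply: cphi; exact: interval_open.
move=> /open_subspaceP[V oV VU].
rewrite setIC -VU; apply: measurableI; last exact: measurable_control_set.
exact: sub_sigma_algebra.
Qed.

Lemma continuous_bounded phi : {within U, continuous phi} ->
  exists M : R, forall u, U u -> `|phi u| <= M.
Proof.
move=> cphi; have /compact_bounded[M [_ HM]] := continuous_compact cphi U_compact.
exists (M + 1) => u Uu; apply: HM; first by rewrite ltrDl.
by exists u.
Qed.

Lemma proba_of1 P : proba_of P U = 1%E.
Proof. exact: set_mem (valP (P : proba_on U)). Qed.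

Lemma integrable_avg P phi : {within U, continuous phi} ->
  (proba_of P).-integrable U (EFin \o phi).
Proof.
move=> cphi; have [M phiM] := continuous_bounded cphi.
apply: (bounded_integrable (M := M)) => //.
- exact: measurable_control_set.
- by rewrite [ltLHS](proba_of1 P) ltry.
- exact: measurable_fun_control_set.
Qed.

Lemma avgD P phi psi : {within U, continuous phi} -> {within U, continuous psi} ->
  avg P (fun u => phi u + psi u) = avg P phi + avg P psi.
Proof.
move=> cphi cpsi; apply: RintegralD; try exact: integrable_avg.
exact: measurable_control_set.
Qed.

Lemma avgB P phi psi : {within U, continuous phi} -> {within U, continuous psi} ->
  avg P (fun u => phi u - psi u) = avg P phi - avg P psi.
Proof.
move=> cphi cpsi; apply: RintegralB; try exact: integrable_avg.
exact: measurable_control_set.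
Qed.

Lemma avgZ P c phi : {within U, continuous phi} ->
  avg P (fun u => c * phi u) = c * avg P phi.
Proof.
move=> cphi; apply: RintegralZl; last exact: integrable_avg.
exact: measurable_control_set.
Qed.

Lemma avg_cst P c : avg P (fun=> c) = c.
Proof.
by rewrite /avg Rintegral_cst ?[X in fine X](proba_of1 P) ?mulr1//; exact: measurable_control_set.
Qed.

Lemma le_avg P phi psi : {within U, continuous phi} -> {within U, continuous psi} ->
  (forall u, U u -> phi u <= psi u) -> avg P phi <= avg P psi.
Proof.
move=> cphi cpsi le; apply: le_Rintegral => //; try exact: integrable_avg.
exact: measurable_control_set.
Qed.

Lemma eq_avg P phi psi : (forall u, U u -> phi u = psi u) -> avg P phi = avg P psi.
Proof. by move=> e; apply: eq_Rintegral => u /set_mem; exact: e. Qed.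

Lemma normr_avg_le P phi M : {within U, continuous phi} ->
  (forall u, U u -> `|phi u| <= M) -> `|avg P phi| <= M.
Proof.
move=> cphi phiM.
have c_cst (c : R) : {within U, continuous (fun=> c)} by exact: within_continuous_cst.
rewrite ler_norml; apply/andP; split.
- rewrite -[leLHS](avg_cst P); apply: le_avg => // u Uu.
  by have := phiM u Uu; rewrite ler_norml => /andP[].
- rewrite -[leRHS](avg_cst P); apply: le_avg => // u Uu.
  by have := phiM u Uu; rewrite ler_norml => /andP[].
Qed.

Lemma normr_avgB_le P phi psi M :
  {within U, continuous phi} -> {within U, continuous psi} ->
  (forall u, U u -> `|phi u - psi u| <= M) -> `|avg P phi - avg P psi| <= M.
Proof.
move=> cphi cpsi M_; rewrite -avgB//; apply: normr_avg_le => //.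
exact: within_continuousB.
Qed.

Lemma test_fun_continuous phi : {within U, continuous phi} -> test_fun U phi.
Proof. by move=> cphi; split=> //; exact: continuous_bounded. Qed.

(** Evaluation at a fixed test function is a coordinate of the map that induces
    the weak topology. *)
Lemma avg_continuous phi : {within U, continuous phi} ->
  continuous (fun P : PU U => avg P phi).
Proof.
move=> cphi; pose f : test_fun U := exist _ phi (mem_set (test_fun_continuous cphi)).
move=> P; apply: (@continuous_comp _ _ _ (@test_eval R p U : PU U -> _)
  (fun g : {ptws test_fun U -> R} => g f)).
  exact: initial_continuous.
exact: (@proj_continuous _ (fun=> R) f).
Qed.

Section Measurability.
Context (t1 : R) (sigma : R -> PU U).
Hypothesis sigma_measurable : relaxed_controls t1 sigma.
Local Notation H := (horizon t1).

Lemma measurable_avg phi : {within U, continuous phi} ->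
  measurable_fun (H : set (lebesgueR R)) (fun t : lebesgueR R => avg (sigma t) phi).
Proof.
move=> cphi; apply: (measurability _ (RGenOpens.measurableE R)).
move=> _ [_ [a [b ->] <-]].
apply: (sigma_measurable (B := [set P | `]a, b[%classic (avg P phi)])).
apply: sub_sigma_algebra.
by move: (avg_continuous cphi) => /continuousP; apply; exact: interval_open.
Qed.

End Measurability.
End Averages.

(** * The Riesz representation theorem on a compact set *)

Section DistanceToComplement.
Context {R : realType} {p : nat} (O : set 'rV[R]_p).

(** The infimum of the empty set is 0, so that this is 0 everywhere, instead of
    infinite, when O is the whole space. *)
Definition dist_compl (u : 'rV[R]_p) : R := inf [set `|u - v| | v in ~` O].

Let lb u : has_lbound [set `|u - v| | v in ~` O].
Proof. by exists 0 => _ [v _ <-]. Qed.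

Lemma dist_compl_out u : ~ O u -> dist_compl u = 0.
Proof.
move=> nOu; apply/eqP; rewrite eq_le; apply/andP; split.
  by apply: ge_inf => //; exists u => //; rewrite subrr normr0.
by apply: lb_le_inf; [exists 0, u => //; rewrite subrr normr0|move=> _ [v _ <-]].
Qed.

Context (v0 : 'rV[R]_p) (nOv0 : ~ O v0).

Lemma dist_compl_ge0 u : 0 <= dist_compl u.
Proof.
by apply: lb_le_inf; [exists `|u - v0|, v0|move=> _ [v _ <-]].
Qed.

Lemma dist_compl_gt0 u : open O -> O u -> 0 < dist_compl u.
Proof.
move=> oO Ou; have /nbhs_ballP[r /= r0 rO] := open_nbhs_nbhs (conj oO Ou).
apply: (lt_le_trans r0); apply: lb_le_inf; first by exists `|u - v0|, v0.
move=> _ [v nOv <-]; rewrite leNgt; apply/negP => uv; apply: nOv; apply: rO.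
by rewrite -ball_normE.
Qed.

Lemma dist_compl_lip u v : dist_compl u <= `|u - v| + dist_compl v.
Proof.
rewrite -lerBlDl; apply: lb_le_inf; first by exists `|v - v0|, v0.
move=> _ [w nOw <-]; rewrite lerBlDl; apply: (@le_trans _ _ `|u - w|).
  by apply: ge_inf => //; exists w.
by rewrite -[u - w](subrKA v) ler_normD.
Qed.

Lemma dist_compl_continuous : continuous dist_compl.
Proof.
move=> u; apply/(@cvgrPdist_lt _ _ _ (nbhs u)) => e e0.
apply: filterS (nbhsx_ballx u e e0) => v; rewrite -ball_normE/= => uv.
apply: le_lt_trans uv; rewrite ler_norml lerBlDr dist_compl_lip andbT.
by rewrite lerNl opprB lerBlDr distrC dist_compl_lip.
Qed.

End DistanceToComplement.

(** The truncations at 1 of the multiples of the distance to the complement.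
    They reach the value 1 at each point of O after finitely many steps; a mere
    convergence to 1 would not preserve the inequality [1 <= g n u] when a cover
    is multiplied by them. *)
Lemma open_exhaustion (R : realType) (p : nat) (O : set 'rV[R]_p) : open O ->
  exists psi : nat -> 'rV[R]_p -> R,
    [/\ forall n, continuous (psi n), forall n u, 0 <= psi n u <= 1,
        forall n u, psi n u <= psi n.+1 u, forall n u, ~ O u -> psi n u = 0 &
        forall u, O u -> exists n, psi n u = 1].
Proof.
move=> oO; have [[v0 nOv0]|all_O] := pselect (exists v, ~ O v); last first.
  have {}all_O u : O u by apply: contrapT => nOu; apply: all_O; exists u.
  exists (fun _ _ => 1); split=> //.
  - by move=> n; exact: cst_continuous.
  - by move=> n u; rewrite ler01 lexx.
pose d := dist_compl O.
have d_ge0 u : 0 <= d u by exact: dist_compl_ge0 nOv0 u.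
exists (fun n u => Num.min 1 (n%:R * d u)); split.
- move=> n u; apply: (@continuous_min R _ (cst 1) (fun u => n%:R * d u) u).
    exact: cst_continuous.
  apply: continuousM; first exact: cst_continuous.
  exact: dist_compl_continuous nOv0 u.
- by move=> n u; rewrite ge_min lexx le_min ler01 mulr_ge0.
- move=> n u; rewrite le_min !ge_min lexx/=; apply/orP; right.
  by rewrite ler_wpM2r// ler_nat.
- by move=> n u nOu; rewrite /d dist_compl_out// mulr0 min_r.
- move=> u Ou; have du : 0 < d u by exact: dist_compl_gt0 nOv0 u oO Ou.
  exists (Num.bound (d u)^-1); rewrite min_l//.
  rewrite -ler_pdivrMr// div1r ltW//.
  by apply: archi_boundP; rewrite invr_ge0.
Qed.

Section RieszOuterMeasure.
Context {R : realType} {p : nat} (U : set 'rV[R]_p).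
Context (L : ('rV[R]_p -> R) -> R).
Implicit Types (A : set 'rV[R]_p) (phi psi : 'rV[R]_p -> R).
Local Notation C phi := {within U, continuous phi}.

Record positive_functional := PositiveFunctional {
  functionalD : forall phi psi, C phi -> C psi ->
    L (fun u => phi u + psi u) = L phi + L psi ;
  functionalZ : forall c phi, C phi -> L (fun u => c * phi u) = c * L phi ;
  functional_ge0 : forall phi, C phi -> (forall u, U u -> 0 <= phi u) -> 0 <= L phi ;
  functional1 : L (fun=> 1) = 1 }.

(** The competitors in the definition of the outer measure of A. A series of
    nonnegative continuous functions, one of whose partial sums is at least 1 at
    each given point of A, is encoded by the increasing sequence of its partial
    sums; [c] bounds the total cost. *)
Record exhausts A (g : nat -> 'rV[R]_p -> R) (c : R) : Prop := Exhausts {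
  exhausts_cont : forall n, C (g n) ;
  exhausts_ge0 : forall n u, U u -> 0 <= g n u ;
  exhausts_nd : forall n u, U u -> g n u <= g n.+1 u ;
  exhausts_cover : forall u, A u -> U u -> exists n, 1 <= g n u ;
  exhausts_cost : forall n, L (g n) <= c }.

Arguments exhausts_cont {A g c} _ n.
Arguments exhausts_ge0 {A g c} _ n u _.
Arguments exhausts_nd {A g c} _ n u _.
Arguments exhausts_cost {A g c} _ n.

Lemma exhausts_le A g c m n u : exhausts A g c -> (m <= n)%N -> U u -> g m u <= g n u.
Proof.
move=> gA + Uu; elim: n => [|n IH]; first by rewrite leqn0 => /eqP ->.
rewrite leq_eqVlt => /predU1P[->//|]; rewrite ltnS => /IH/le_trans; apply.
exact: exhausts_nd gA _ _ Uu.
Qed.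

Definition riesz_outer A : \bar R :=
  (inf [set c | exists g, exhausts A g c])%:E.

Hypothesis HL : positive_functional.
Hypothesis U_compact : compact U.

Lemma functional_le phi psi : C phi -> C psi ->
  (forall u, U u -> phi u <= psi u) -> L phi <= L psi.
Proof.
move=> cphi cpsi le.
rewrite [psi](_ : _ = fun u => phi u + (psi u - phi u)); last first.
  by apply/funext => u; rewrite addrC subrK.
rewrite functionalD//; last exact: within_continuousB.
rewrite lerDl; apply: functional_ge0 => //; first exact: within_continuousB.
by move=> u Uu; rewrite subr_ge0 le.
Qed.

Lemma functional_cst c : L (fun=> c) = c.
Proof.
rewrite (_ : (fun=> c) = fun u => c * (fun=> 1) u); last first.
  by apply/funext => u; rewrite mulr1.
rewrite functionalZ ?functional1 ?mulr1//; exact: within_continuous_cst.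
Qed.

Lemma functionalB phi psi : C phi -> C psi ->
  L (fun u => phi u - psi u) = L phi - L psi.
Proof.
move=> cphi cpsi; apply/eqP; rewrite eq_sym subr_eq -functionalD//.
  by apply/eqP; congr L; apply/funext => u; rewrite subrK.
exact: within_continuousB.
Qed.

Let lb A : has_lbound [set c | exists g, exhausts A g c].
Proof.
exists 0 => c [g gA]; apply: le_trans (exhausts_cost gA 0%N).
by apply: functional_ge0 => //; [exact: exhausts_cont gA _|exact: exhausts_ge0 gA _].
Qed.

Lemma exhausts1 : exhausts setT (fun _ _ => 1) 1.
Proof.
split=> //; first by move=> _; exact: within_continuous_cst.
by move=> n; rewrite functional1.
Qed.

Lemma exhaustsS A B g c : A `<=` B -> exhausts B g c -> exhausts A g c.
Proof. by move=> AB [*]; split => // u Au; auto. Qed.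

Let nonempty A : [set c | exists g, exhausts A g c] !=set0.
Proof. exists 1, (fun _ _ => 1); exact: exhaustsS exhausts1. Qed.

Lemma riesz_outer_le A g c : exhausts A g c -> (riesz_outer A <= c%:E)%E.
Proof. by move=> gA; rewrite lee_fin; apply: ge_inf => //; exists g. Qed.

Lemma le_riesz_outer A c : (forall g c', exhausts A g c' -> c <= c') ->
  (c%:E <= riesz_outer A)%E.
Proof. by move=> h; rewrite lee_fin; apply: lb_le_inf => // c' [g /h]. Qed.

Lemma riesz_outer_adherent A e : 0 < e ->
  exists g c, exhausts A g c /\ (c%:E <= riesz_outer A + e%:E)%E.
Proof.
move=> e0; have [//|c [g gA] ce] := inf_adherent (E := [set c | exists g, exhausts A g c]) e0.
by exists g, c; split => //; rewrite -EFinD lee_fin ltW.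
Qed.

Lemma riesz_outer_ge0 A : (0 <= riesz_outer A)%E.
Proof.
apply: le_riesz_outer => g c gA; apply: le_trans (exhausts_cost gA 0%N).
by apply: functional_ge0 => //; [exact: exhausts_cont gA _|exact: exhausts_ge0 gA _].
Qed.

Lemma riesz_outer0 : riesz_outer set0 = 0%E.
Proof.
apply/eqP; rewrite eq_le riesz_outer_ge0 andbT.
apply: (@riesz_outer_le _ (fun _ _ => 0)); split => //.
  by move=> _; exact: within_continuous_cst.
by move=> n; rewrite functional_cst.
Qed.

Lemma riesz_outerS A B : A `<=` B -> (riesz_outer A <= riesz_outer B)%E.
Proof.
by move=> AB; apply: le_riesz_outer => g c /(exhaustsS AB)/riesz_outer_le; rewrite lee_fin.
Qed.

(** As in Dini's theorem: if the members of an increasing sequence reach the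
    value 1 at each point of U, then by compactness one of them is at least
    [1 - e] on all of U. *)
Lemma riesz_outer1 : riesz_outer U = 1%E.
Proof.
apply/eqP; rewrite eq_le; apply/andP; split.
  by apply: riesz_outer_le; apply: exhaustsS exhausts1.
apply: le_riesz_outer => g c gU; apply/ler_addgt0Pr => e e0.
suff [n gn] : exists n, forall u, U u -> 1 - e <= g n u.
  rewrite -lerBlDr -[leLHS]functional_cst.
  apply: le_trans (exhausts_cost gU n).
  apply: functional_le => //; first exact: within_continuous_cst.
  exact: exhausts_cont gU _.
move: U_compact => /compact_near_coveringP/near_covering_withinP cov.
have : \forall n \near \oo, U `<=` [set u | 1 - e <= g n u].
  apply: cov => u Uu; have [n gnu] := exhausts_cover gU Uu Uu.
  have /subspace_continuousP/(_ u Uu) : C (g n) := exhausts_cont gU n.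
  move=> /(@cvgrPdist_lt _ _ _ (within U (nbhs u)))/(_ e e0).
  rewrite near_withinE => near_u.
  exists ([set v | U v -> `|g n u - g n v| < e], [set m | (n <= m)%N]).
    by split=> //; exists n.
  move=> [v m] /= [+ nm] Uv => /(_ Uv); rewrite ltr_norml => /andP[_ guv].
  apply: le_trans (exhausts_le gU nm Uv).
  by rewrite lerBlDr (le_trans gnu)// -lerBlDl ltW.
by move=> [n _ /(_ n (leqnn n))]; exists n.
Qed.

Lemma riesz_outer_setIU A : riesz_outer A = riesz_outer (A `&` U).
Proof.
apply/eqP; rewrite eq_le [X in _ && X]riesz_outerS ?andbT; last exact: subIsetl.
apply: le_riesz_outer => g c gA; suff /riesz_outer_le : exhausts A g c by rewrite lee_fin.
by case: gA => ? ? ? cov ?; split=> // u Au Uu; exact: cov.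
Qed.

(** Competitors for the sets [F i], with costs optimal up to [e / 2 ^+ i.+1], are
    added along the triangle: the n-th function is the sum over [i <= n] of the
    n-th functions of the competitors for [F i]. *)
Lemma riesz_outer_sigma_subadditive : sigma_subadditive riesz_outer.
Proof.
move=> F; apply/lee_addgt0Pr => e e0.
have eV n : 0 < e / 2 ^+ n.+1 by rewrite divr_gt0// exprn_gt0.
have /choice[gc gcP] n : exists gc : (nat -> 'rV[R]_p -> R) * R,
    exhausts (F n) gc.1 gc.2 /\ (gc.2%:E <= riesz_outer (F n) + (e / 2 ^+ n.+1)%:E)%E.
  by have [g [c gcP]] := riesz_outer_adherent (F n) (eV n); exists (g, c).
have gP n := (gcP n).1.
have [->|] := eqVneq (\sum_(i <oo) riesz_outer (F i))%E +oo%E; first by rewrite leey.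
rewrite -ltey -ge0_fin_numE; last first.
  by apply: nneseries_ge0 => *; exact: riesz_outer_ge0.
move=> Sfin; rewrite -(fineK Sfin) -EFinD; set S := fine _.
have sumS n : \sum_(i < n) (gc i).2 <= S + e.
  apply: (@le_trans _ _ (\sum_(i < n) (fine (riesz_outer (F i)) + e / 2 ^+ i.+1))).
    by apply: ler_sum => i _; have [_ /=] := gcP i; rewrite -EFinD lee_fin.
  rewrite big_split/= lerD//.
    rewrite -lee_fin -sumEFin /S fineK// -(big_mkord xpredT (riesz_outer \o F)).
    by apply: nneseries_lim_ge => *; exact: riesz_outer_ge0.
  rewrite (_ : \sum_(i < n) _ = e - e / 2 ^+ n) ?gerBl ?divr_ge0 ?ltW ?exprn_gt0//.
  elim: n => [|n IH]; first by rewrite big_ord0 expr0 divr1 subrr.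
  by rewrite big_ord_recr/= IH exprS; field; rewrite expf_neq0.
apply: (@riesz_outer_le _ (fun n u => \sum_(i < n.+1) (gc i).1 n u)); split.
- by move=> n; apply: within_continuous_sum => i; exact: exhausts_cont (gP i) _.
- by move=> n u Uu; apply: sumr_ge0 => i _; exact: exhausts_ge0 (gP i) _ _ Uu.
- move=> n u Uu; rewrite [leRHS]big_ord_recr/= ler_wpDr//.
    exact: exhausts_ge0 (gP _) _ _ Uu.
  by apply: ler_sum => i _; exact: exhausts_nd (gP i) _ _ Uu.
- move=> u [i _ Fiu] Uu; have [n gn] := exhausts_cover (gP i) Fiu Uu.
  exists (maxn i n); have im : (i < (maxn i n).+1)%N by rewrite ltnS leq_maxl.
  rewrite (bigD1 (Ordinal im))//= ler_wpDr//.
    by apply: sumr_ge0 => j _; exact: exhausts_ge0 (gP j) _ _ Uu.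
  by apply: (le_trans gn); apply: exhausts_le (gP i) _ Uu; rewrite leq_maxr.
- move=> n.
  have -> : L (fun u => \sum_(i < n.+1) (gc i).1 n u) = \sum_(i < n.+1) L ((gc i).1 n).
    elim: n.+1 => [|k IH].
      rewrite big_ord0 -[RHS](functional_cst 0); congr L.
      by apply/funext => u; rewrite big_ord0.
    rewrite big_ord_recr/= -IH -functionalD//.
    - by congr L; apply/funext => u; rewrite big_ord_recr.
    - by apply: within_continuous_sum => i; exact: exhausts_cont (gP i) n.
    - exact: exhausts_cont (gP k) n.
  apply: le_trans (sumS n.+1); apply: ler_sum => i _.
  exact: exhausts_cost (gP i) _.
Qed.

End RieszOuterMeasure.

Arguments exhausts_cont {R p U L A g c} _ n.
Arguments exhausts_ge0 {R p U L A g c} _ n u _.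
Arguments exhausts_nd {R p U L A g c} _ n u _.
Arguments exhausts_cost {R p U L A g c} _ n.

Section RieszMeasure.
Context {R : realType} {p : nat} (U : set 'rV[R]_p).
Context (L : ('rV[R]_p -> R) -> R).
Implicit Types (A : set 'rV[R]_p) (phi psi : 'rV[R]_p -> R).
Local Notation C phi := {within U, continuous phi}.
Local Notation riesz := (riesz_outer U L).
Hypothesis HL : positive_functional U L.
Hypothesis U_compact : compact U.

(** A cover [g] of X is cut by an exhaustion [psi] of the open set O: the
    products [g n * psi n] cover X inside O, while [g n * (1 - psi m)] covers X
    outside O for each m; the two costs add up to at most the cost of [g]. *)
Lemma caratheodory_open (O : set 'rV[R]_p) : open O ->
  forall X, (riesz (X `&` O) + riesz (X `&` ~` O) <= riesz X)%E.
Proof.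
move=> /open_exhaustion[psi [psi_cont psi01 psi_nd psi_out psi_in]] X.
have psi_ge0 n u : 0 <= psi n u by have /andP[] := psi01 n u.
have psi_le1 n u : psi n u <= 1 by have /andP[] := psi01 n u.
have Cpsi n : C (psi n) by apply: continuous_subspaceT; exact: psi_cont.
have psi_le m n u : (m <= n)%N -> psi m u <= psi n u.
  elim: n => [|n IH]; first by rewrite leqn0 => /eqP ->.
  rewrite leq_eqVlt => /predU1P[->//|]; rewrite ltnS => /IH/le_trans; apply.
  exact: psi_nd.
apply: (le_trans _ (le_refl _)); rewrite /riesz_outer -EFinD.
apply: le_riesz_outer => // g c gX.
pose a m := L (fun u => g m u * psi m u).
have Cgpsi n m : C (fun u => g n u * psi m u).
  by apply: within_continuousM => //; exact: exhausts_cont gX n.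
have out m : (riesz (X `&` ~` O) <= (c - a m)%:E)%E.
  apply: (@riesz_outer_le _ _ _ _ HL _
    (fun n u => g (n + m)%N u - g (n + m)%N u * psi m u)); split.
  - move=> n; apply: within_continuousB; last exact: Cgpsi.
    exact: exhausts_cont gX _.
  - by move=> n u Uu; rewrite subr_ge0 ler_piMr// (exhausts_ge0 gX).
  - move=> n u Uu; have := exhausts_nd gX (n + m)%N u Uu.
    have := psi_le1 m u; rewrite addSn; nra.
  - move=> u [Xu /psi_out Ou] Uu; have [n gn] := exhausts_cover gX Xu Uu.
    exists n; rewrite Ou mulr0 subr0 (le_trans gn)//.
    by apply: exhausts_le gX _ Uu; rewrite leq_addr.
  - move=> n; rewrite (functionalB HL)//; last exact: exhausts_cont gX _.
    apply: lerB; first exact: exhausts_cost gX _.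
    apply: (functional_le HL) => // u Uu; apply: ler_wpM2r => //.
    by apply: exhausts_le gX _ Uu; rewrite leq_addl.
have : (riesz (X `&` O) <= (c - fine (riesz (X `&` ~` O)))%:E)%E.
  apply: (@riesz_outer_le _ _ _ _ HL _ (fun n u => g n u * psi n u)); split.
  - by move=> n; exact: Cgpsi.
  - by move=> n u Uu; rewrite mulr_ge0// (exhausts_ge0 gX).
  - move=> n u Uu; apply: ler_pM => //; first exact: exhausts_ge0 gX _ _ Uu.
    exact: exhausts_nd gX _ _ Uu.
  - move=> u [Xu Ou] Uu; have [n gn] := exhausts_cover gX Xu Uu.
    have [m psim] := psi_in u Ou; exists (maxn n m).
    rewrite -[1]mulr1; apply: ler_pM => //.
      by rewrite (le_trans gn)// (exhausts_le gX)// leq_maxl.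
    by rewrite -psim psi_le// leq_maxr.
  - by move=> n; have := out n; rewrite lee_fin lerBrDl -lerBrDr.
by rewrite lee_fin lerBrDr.
Qed.

(** By [caratheodory_open] the Caratheodory sigma-algebra of the outer measure
    contains the Borel one, on which the outer measure is a measure. *)
Lemma riesz_measure :
  exists P : PU U, forall A, measurable (A : set (borelRV R p)) -> proba_of P A = riesz A.
Proof.
pose mu : {outer_measure set 'rV[R]_p -> \bar R} := HB.pack riesz
  (isOuterMeasure.Build R 'rV[R]_p riesz (riesz_outer0 HL) (riesz_outer_ge0 HL)
    (riesz_outerS HL) (riesz_outer_sigma_subadditive HL)).
have sub : <<s @open 'rV[R]_p >> `<=` mu.-cara.-measurable.
  apply: smallest_sub; first exact: (@sigma_algebra_measurable _ (caratheodory_type mu)).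
  by move=> O oO; apply: le_caratheodory_measurable; exact: caratheodory_open.
have additive : semi_sigma_additive (riesz : set (borelRV R p) -> \bar R).
  move=> F mF tF mUF.
  apply: (@measure_semi_sigma_additive _ (caratheodory_type mu) R mu F) => //.
    by move=> i; apply: sub; exact: mF.
  by apply: sub; exact: mUF.
pose m : {measure set (borelRV R p) -> \bar R} := HB.pack (riesz : set (borelRV R p) -> \bar R)
  (isMeasure.Build _ (borelRV R p) R riesz (riesz_outer0 HL) (riesz_outer_ge0 HL) additive).
have riesz1 : riesz U = 1%E by exact: riesz_outer1.
have mT : m setT = 1%E by rewrite /m/= riesz_outer_setIU// setTI.
pose P : probability (borelRV R p) R := HB.pack (riesz : set (borelRV R p) -> \bar R) m
  (Measure_isProbability.Build _ _ _ _ mT).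
have PU1 : proba_on U P by exact: riesz1.
by exists (exist _ P (mem_set PU1) : proba_on U).
Qed.

End RieszMeasure.

Section RieszRepresentation.
Context {R : realType} {p : nat} (U : set 'rV[R]_p).
Context (L : ('rV[R]_p -> R) -> R).
Implicit Types (A : set 'rV[R]_p) (phi psi : 'rV[R]_p -> R).
Local Notation C phi := {within U, continuous phi}.
Hypothesis HL : positive_functional U L.
Hypothesis U_compact : compact U.

(** The part of the graph of phi between the heights [i * h] and [i.+1 * h]. *)
Definition slice phi (h : R) i u :=
  Num.min (phi u) (i.+1%:R * h) - Num.min (phi u) (i%:R * h).

Section OneMeasure.
Context (P : PU U).
Hypothesis PE : forall A, measurable (A : set (borelRV R p)) ->
  proba_of P A = riesz_outer U L A.

(** On the set B where [phi >= i.+1 * h] the slice number i is full, equal to h,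
    so that [h^-1] times it competes for the outer measure of B; and the next
    slice is at most h on B and vanishes outside B. *)
Lemma avg_slice_le phi (h : R) i : C phi -> 0 < h ->
  avg P (slice phi h i.+1) <= L (slice phi h i).
Proof.
move=> cphi h0.
have Cmin (c : R) : C (fun u => Num.min (phi u) c).
  by apply: within_continuous_min => //; exact: within_continuous_cst.
have Cslice j : C (slice phi h j) by exact: within_continuousB.
pose B := U `&` phi @^-1` `[i.+1%:R * h, +oo[.
have mU := @measurable_control_set _ _ _ U_compact.
have mB : measurable (B : set (borelRV R p)).
  by apply: measurable_fun_control_set.
have PB : (proba_of P B <= (h^-1 * L (slice phi h i))%:E)%E.
  rewrite PE// -(functionalZ HL)//.
  apply: (@riesz_outer_le _ _ _ _ HL _ (fun _ u => h^-1 * slice phi h i u)); split => //.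
  - by move=> _; exact: within_continuousZ.
  - move=> _ u Uu; rewrite mulr_ge0 ?invr_ge0 ?(ltW h0)// subr_ge0.
    by rewrite le_min !ge_min lexx/= ler_wpM2r ?orbT ?ler_nat// ltW.
  - move=> u [_ /=]; rewrite in_itv/= andbT => hphi _; exists 0%N.
    rewrite /slice min_r// min_r; last first.
      by rewrite (le_trans _ hphi)// ler_wpM2r ?ler_nat// ltW.
    by rewrite -mulrBl -natrB// subSnn mul1r mulVf ?gt_eqF.
apply: (@le_trans _ _ (avg P (fun u => \1_B u * h))).
  apply: le_Rintegral => //; first exact: integrable_avg.
    apply: (bounded_integrable (M := h)) => //.
    - by rewrite [ltLHS](proba_of1 P) ltry.
    - by apply: measurable_funM => //; exact: measurable_indic.
    - move=> u _; rewrite normrM (gtr0_norm h0) ger_pMl// indicE.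
      by case: (_ \in _); rewrite ?normr1 ?normr0.
  move=> u Uu; rewrite indicE /slice; have [uB|uB] := boolP (u \in B).
    rewrite mul1r lerBlDr ge_min; apply/orP; right.
    have [_ /=] := set_mem uB; rewrite in_itv/= andbT => hphi.
    by rewrite min_r// -[i.+2%:R]natr1 mulrDl mul1r addrC.
  have phih : phi u <= i.+1%:R * h.
    by rewrite leNgt; apply/negP => /ltW hphi; move/negP: uB; apply; apply/mem_set;
      split => //=; rewrite in_itv/= hphi.
  rewrite mul0r (min_l phih) min_l ?subrr//.
  by rewrite (le_trans phih)// ler_wpM2r ?ler_nat// ltW.
rewrite /avg Rintegral_indic_restr Rintegral_cst; last by apply: measurableI.
rewrite setIA setIid -/B.
move: PB; rewrite -[in X in (X <= _)%E -> _](@fineK _ (proba_of P B)); last first.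
  by rewrite fin_num_measure.
by rewrite lee_fin ler_pdivlMl.
Qed.

(** The slice estimates telescope. The shift of the index by one costs the
    average of the lowest slice, hence at most h. *)
Lemma avg_le_functional phi : C phi -> (forall u, U u -> 0 <= phi u) ->
  avg P phi <= L phi.
Proof.
move=> cphi phi0; apply/ler_addgt0Pr => h h0.
pose s i u := Num.min (phi u) (i%:R * h).
have Cs i : C (s i).
  by apply: within_continuous_min => //; exact: within_continuous_cst.
have sle k : avg P (s k.+1) <= h + L (s k).
  elim: k => [|k IH].
    rewrite -[leLHS]addr0 lerD//.
      rewrite -[leRHS](avg_cst U_compact P); apply: le_avg => //.
        exact: within_continuous_cst.
      by move=> u Uu; rewrite /s mul1r ge_min lexx orbT.
    by apply: (functional_ge0 HL) => // u Uu; rewrite le_min mul0r lexx phi0.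
  move: IH; rewrite -lerBlDr => IH.
  have := avg_slice_le k cphi h0.
  have -> : L (slice phi h k) = L (s k.+1) - L (s k) := functionalB HL (Cs _) (Cs _).
  have -> : avg P (slice phi h k.+1) = avg P (s k.+2) - avg P (s k.+1).
    exact: avgB (Cs _) (Cs _).
  lra.
have [M phiM] := continuous_bounded U_compact cphi.
pose K := Num.bound `|M / h|.
have sE j u : (K <= j)%N -> U u -> s j u = phi u.
  move=> Kj Uu; rewrite /s min_l//.
  apply: (le_trans (ler_norm _)); apply: (le_trans (phiM u Uu)).
  rewrite -ler_pdivrMr//; apply: (@le_trans _ _ K%:R); last by rewrite ler_nat.
  by rewrite (le_trans (ler_norm _))// ltW// archi_boundP.
have := sle K; rewrite (@eq_avg _ _ _ _ (s K.+1) phi); last first.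
  by move=> u Uu; rewrite sE.
move=> /le_trans; apply; rewrite addrC lerD2r.
by apply: (functional_le HL) => // u Uu; rewrite sE.
Qed.

(** The converse inequality is the same one for the reflected function
    [M - phi], since both sides are linear and agree on constants. *)
Lemma avg_eq_functional phi : C phi -> avg P phi = L phi.
Proof.
move=> cphi; have [M phiM] := continuous_bounded U_compact cphi.
have CM : C (fun=> M) by exact: within_continuous_cst.
have /= h2 := @avg_le_functional (fun u => M + phi u) (within_continuousD CM cphi).
have /= h1 := @avg_le_functional (fun u => M - phi u) (within_continuousB CM cphi).
rewrite (avgD U_compact P CM cphi) (functionalD HL CM cphi) in h2.
rewrite (avgB U_compact P CM cphi) (functionalB HL CM cphi) in h1.
rewrite (avg_cst U_compact) (functional_cst HL) in h1 h2.
apply/eqP; rewrite eq_le; apply/andP; split.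
  rewrite -(lerD2l M); apply: h2 => u Uu.
  by have := phiM u Uu; rewrite ler_norml => /andP[]; lra.
rewrite -lerN2 -(lerD2l M); apply: h1 => u Uu.
by have := phiM u Uu; rewrite ler_norml => /andP[]; lra.
Qed.

End OneMeasure.

Theorem riesz_representation :
  exists P : PU U, forall phi, C phi -> avg P phi = L phi.
Proof.
have [P PE] := riesz_measure HL U_compact.
by exists P; exact: avg_eq_functional.
Qed.

End RieszRepresentation.

(** * A countable uniformly dense family and the weak topology *)

Lemma heine_cantor (R : realType) (X : pseudoMetricType R) (K : set X) (g : X -> R) :
  compact K -> {within K, continuous g} -> forall e, 0 < e ->
  exists2 d, 0 < d & forall x y, K x -> K y -> ball x d y -> `|g x - g y| < e.
Proof.
move=> /compact_near_coveringP cK cg e e0.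
have e20 : 0 < e / 2 by rewrite divr_gt0.
have : \forall d \near 0^'+, K `<=` [set x | forall y, K x -> K y -> ball x d y -> `|g x - g y| < e].
  apply: (cK _ 0^'+) => x Kx.
  have /subspace_continuousP/(_ x Kx) := cg.
  move=> /(@cvgrPdist_lt _ _ _ (within K (nbhs x)))/(_ _ e20).
  rewrite near_withinE => /nbhs_ballP[r /= r0 xr].
  exists (ball x (r / 2), [set d | 0 < d < r / 2]) => /=.
    split; first by apply: nbhsx_ballx; rewrite divr_gt0.
    near=> d; apply/andP; split; near: d; first exact: nbhs_right_gt.
    by apply: nbhs_right_lt; rewrite divr_gt0.
  move=> [x' d] /= [xx' /andP[d0 dr]] y Kx' Ky x'y.
  rewrite -(subrKA (g x)) (le_lt_trans (ler_normD _ _))// [ltRHS]splitr ltrD//.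
    rewrite distrC; apply: xr => //=; apply: le_ball xx'.
    by move: r0; lra.
  apply: xr => //=; rewrite (splitr r); apply: ball_triangle xx' _.
  exact: le_ball (ltW dr) _ x'y.
move=> h; near (0 : R)^'+ => d; exists d => // x y Kx Ky.
by move: (x) Kx y Ky; near: d; apply: filterS h => d' + x' Kx' y' Ky'; exact.
Unshelve. all: by end_near. Qed.

Section LipschitzFamily.
Context {R : realType} {p : nat}.
Implicit Types (U : set 'rV[R]_p).

(** A finite list of vertices (a, q), with rational coordinates and heights, and a
    common slope m. *)
Definition mcshane_index := (seq ('rV[rat]_p * rat) * nat)%type.

Definition cone (m : nat) (aq : 'rV[rat]_p * rat) (u : 'rV[R]_p) : R :=
  ratr aq.2 + m%:R * `|u - map_mx ratr aq.1|.

(** The lower envelope of the cones of slope m based at the vertices, which is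
    the McShane extension of the data (a, q) cut off at the height m. *)
Definition mcshane (i : mcshane_index) (u : 'rV[R]_p) : R :=
  foldr (fun aq => Num.min (cone i.2 aq u)) i.2%:R i.1.

Lemma mcshane_continuous i : continuous (mcshane i).
Proof.
case: i => s m; rewrite /mcshane /=; elim: s => [|aq s IH] u /=.
  exact: cst_continuous.
apply: (@continuous_min R _ (cone m aq) _ u); last exact: IH.
have nF : Filter (nbhs u) by exact: nbhs_filter.
rewrite /cone; apply: (@cvgD _ _ _ (nbhs u)); first exact: cvg_cst.
apply: (@cvgM _ _ (nbhs u)); first exact: cvg_cst.
apply: cvg_norm; apply: (@cvgB _ _ _ (nbhs u)); last exact: cvg_cst.
exact: cvg_id.
Qed.

Lemma mcshane_le s m u aq : aq \in s -> mcshane (s, m) u <= cone m aq u.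
Proof.
rewrite /mcshane/=; elim: s => //= x s IH; rewrite inE ge_min => /predU1P[->|/IH->].
  by rewrite lexx.
by rewrite orbT.
Qed.

Lemma le_mcshane s m u c : c <= m%:R -> (forall aq, aq \in s -> c <= cone m aq u) ->
  c <= mcshane (s, m) u.
Proof.
move=> cm; rewrite /mcshane/=; elim: s => //= x s IH cs.
rewrite le_min cs ?mem_head//=; apply: IH => aq aqs.
by apply: cs; rewrite inE aqs orbT.
Qed.

Lemma rat_approx (x : R) (e : R) : 0 < e -> exists q : rat, `|x - ratr q| < e.
Proof.
move=> e0; have xe : x - e < x + e by rewrite ltrBlDr -addrA ltrDl addr_gt0.
have [q qxe] := rat_in_itvoo xe; exists q; move: qxe; rewrite in_itv/= ltr_norml => /andP[? ?].
by apply/andP; split; lra.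
Qed.

Lemma ratmx_approx (v : 'rV[R]_p) (e : R) : 0 < e ->
  exists a : 'rV[rat]_p, `|v - map_mx ratr a| < e.
Proof.
move=> e0; have /choice[q qP] i : exists q : rat, `|v ord0 i - ratr q| < e by exact: rat_approx.
exists (\row_i q i).
suff : ball v e (map_mx ratr (\row_i q i)) by rewrite -ball_normE.
by split => // i j; rewrite !mxE ord1; apply: qP.
Qed.

(** The vertices are rational approximations of the values of phi on a finite
    r-net of U. Near a vertex the envelope is below phi plus a small error by the
    choice of the net; it cannot fall much below phi, because a close vertex has
    nearly the height of phi and, by the size of the slope m, the cone of a
    distant vertex has already risen above the whole range of phi. *)
Lemma mcshane_dense U phi e : compact U -> {within U, continuous phi} -> 0 < e ->
  exists i, forall u, U u -> `|phi u - mcshane i u| <= e.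
Proof.
move=> cU cphi e0; pose e3 := e / 3; have e30 : 0 < e3 by rewrite divr_gt0.
have e3E : e = 3 * e3 by rewrite /e3; field.
have [M0 phiM0] := continuous_bounded cU cphi.
pose M := `|M0|; have M_ge0 : 0 <= M by exact: normr_ge0.
have phiM u : U u -> `|phi u| <= M.
  by move=> /phiM0/le_trans; apply; rewrite ler_norm.
have [d d0 phid] := heine_cantor cU cphi e30.
(* slope for which a cone rises by [2 * M + e3] within the distance [d / 2] *)
pose m := Num.bound (M + 2 * (2 * M + e3) / d).
have mP : M + 2 * (2 * M + e3) / d < m%:R.
  by apply: archi_boundP; rewrite !addr_ge0// divr_ge0// ?mulr_ge0// ?addr_ge0// ?mulr_ge0// ltW.
have dM : 0 <= 2 * (2 * M + e3) / d by rewrite divr_ge0 ?mulr_ge0 ?addr_ge0 ?mulr_ge0// ltW.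
have m0 : 0 < m%:R :> R by apply: le_lt_trans mP; rewrite addr_ge0.
have mM : M <= m%:R by lra.
have md : 2 * M + e3 <= m%:R * (d / 2).
  have : 2 * (2 * M + e3) / d <= m%:R by lra.
  rewrite ler_pdivrMr//; lra.
(* the vertex of a net point is at distance less than r from it; over the distance
   [2 * r] the cones rise by at most e3 *)
pose r := Num.min (d / 2) (e3 / (2 * m%:R)).
have r0 : 0 < r by rewrite lt_min !divr_gt0// mulr_gt0.
have rd : r <= d / 2 by rewrite ge_min lexx.
have rm : m%:R * (2 * r) <= e3.
  have : r <= e3 / (2 * m%:R) by rewrite ge_min lexx orbT.
  by rewrite ler_pdivlMr ?mulr_gt0//; lra.
have [D DU Dcov] : finite_subset_cover U (fun v => (ball v r)°) U.
  move: cU; rewrite compact_cover; apply; first by move=> v _; exact: open_interior.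
  by move=> u Uu; exists u => //; exact: nbhsx_ballx.
have /choice[a aP] v : exists a : 'rV[rat]_p, `|v - map_mx ratr a| < r by exact: ratmx_approx.
have /choice[q qP] v : exists q : rat, `|phi v - ratr q| < e3 by exact: rat_approx.
exists ([seq (a v, q v) | v <- finmap.enum_fset D], m) => u Uu.
have tri (x y z : 'rV[R]_p) : `|x - z| <= `|x - y| + `|y - z|.
  by rewrite -(subrKA y x) ler_normD.
rewrite ler_distl; apply/andP; split.
  have [v vD /interior_subset] := Dcov u Uu; rewrite -ball_normE/= => vu.
  have Uv : U v by apply/set_mem/DU.
  have := @mcshane_le [seq (a v, q v) | v <- finmap.enum_fset D] m u (a v, q v).
  move=> /(_ (map_f _ vD)) => le1.
  have : cone m (a v, q v) u <= ratr (q v) + e3.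
    rewrite lerD2l/=; apply: le_trans rm; rewrite ler_wpM2l ?(ltW m0)//.
    have := tri u v (map_mx ratr (a v)); have := aP v; rewrite (distrC u v); move: vu; lra.
  have uv : ball u d v by rewrite -ball_normE/= distrC; move: vu; lra.
  have := phid u v Uu Uv uv; have := qP v.
  rewrite !ltr_norml => /andP[? ?] /andP[? ?]; lra.
rewrite -lerBlDr; apply: le_mcshane.
  by have := phiM u Uu; rewrite ler_norml => /andP[]; lra.
move=> _ /mapP[v vD ->]; have Uv : U v by apply/set_mem/DU.
rewrite /cone/=; have := qP v; rewrite ltr_norml => /andP[q1 q2].
have [near|far] := ltP `|u - map_mx ratr (a v)| (d / 2).
  have uv : ball u d v.
    rewrite -ball_normE/=; have := tri u (map_mx ratr (a v)) v; have := aP v.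
    rewrite (distrC v); lra.
  have := phid u v Uu Uv uv; rewrite ltr_norml => /andP[? ?].
  have : 0 <= m%:R * `|u - map_mx ratr (a v)| by rewrite mulr_ge0.
  lra.
have : m%:R * (d / 2) <= m%:R * `|u - map_mx ratr (a v)| by rewrite ler_wpM2l ?(ltW m0).
have := phiM u Uu; have := phiM v Uv; rewrite !ler_norml => /andP[? ?] /andP[? ?].
lra.
Qed.

End LipschitzFamily.

Section CountableBase.
Context {R : realType} {p : nat} (U : set 'rV[R]_p).
Hypothesis U_compact : compact U.
Implicit Types (phi psi : 'rV[R]_p -> R).
Local Notation C phi := {within U, continuous phi}.

Let index := seq (mcshane_index (p := p) * (rat * rat))%type.

Definition weak_box (l : index) : set (PU U) :=
  [set P | forall x, x \in l -> ratr x.2.1 < avg P (mcshane x.1) < ratr x.2.2].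

Let Cmc i : C (@mcshane R p i).
Proof. by apply: continuous_subspaceT; exact: mcshane_continuous. Qed.

(** Evaluations at McShane functions with rational data already generate the
    weak topology, because such functions are uniformly dense in C(U). *)
Lemma weak_box_base (B : set (PU U)) P : open B -> B P ->
  exists2 l, weak_box l P & weak_box l `<=` B.
Proof.
move=> oB BP; pose F := filter_from [set l | weak_box l P] weak_box.
have FF : Filter F.
  apply: filter_from_filter; first by exists [::].
  move=> l1 l2 l1P l2P; exists (l1 ++ l2).
    by move=> x; rewrite mem_cat => /orP[/l1P|/l2P].
  by move=> Q lQ; split=> x xl; apply: lQ; rewrite mem_cat xl ?orbT.
suff : F B by case=> l lP lB; exists l.
move: oB => [V oV VB].
have : (@test_eval R p U : PU U -> {ptws test_fun U -> R}) @ F --> test_eval P.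
  apply/cvg_sup => phi A [_ [[W oW <-] /= WP] WA].
  pose phi' : 'rV[R]_p -> R := \val phi.
  have Cphi : C phi' by case: (set_mem (valP phi)).
  have /nbhs_ballP[e /= e0 eW] : nbhs (avg P phi') W by apply: open_nbhs_nbhs.
  pose e4 := e / 4; have e40 : 0 < e4 by rewrite divr_gt0.
  have eE : e = 4 * e4 by rewrite /e4; field.
  have [i phii] := mcshane_dense U_compact Cphi e40.
  have e42 : 0 < e4 / 2 by rewrite divr_gt0.
  have [a aP] := rat_approx (avg P (mcshane i) - e4 / 2) e42.
  have [b bP] := rat_approx (avg P (mcshane i) + e4 / 2) e42.
  exists [:: (i, (a, b))].
    move=> x; rewrite inE => /eqP ->/=.
    by move: aP bP; rewrite !ltr_norml => /andP[? ?] /andP[? ?]; apply/andP; split; lra.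
  move=> Q /(_ _ (mem_head _ _))/= /andP[aQ Qb].
  have := normr_avgB_le U_compact P Cphi (@Cmc i) phii.
  have := normr_avgB_le U_compact Q Cphi (@Cmc i) phii.
  move=> h1 h2; apply: WA; suff : ball (avg P phi') e (avg Q phi') by exact: eW.
  rewrite -ball_normE/=; move: h1 h2.
  move: aP bP; rewrite !ltr_norml !ler_norml => /andP[? ?] /andP[? ?] /andP[? ?] /andP[? ?].
  by apply/andP; split; lra.
move=> /(_ V); rewrite -VB; apply; apply: open_nbhs_nbhs; split => //.
by rewrite -VB in BP.
Qed.

(** Every open set of probability measures is a countable union of boxes
    [weak_box l], so measurability of the averages is enough. *)
Lemma relaxed_controls_avg (t1 : R) (sigma : R -> PU U) :
  (forall phi, C phi -> measurable_fun (horizon t1 : set (lebesgueR R))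
     (fun t : lebesgueR R => avg (sigma t) phi)) ->
  relaxed_controls t1 sigma.
Proof.
move=> msigma; have mH := measurable_horizon t1; pose M := [set B : set (PU U) |
  measurable (horizon t1 `&` sigma @^-1` B : set (lebesgueR R))].
have mbox l : M (weak_box l).
  rewrite /M/=; elim: l => [|[i [a b]] l IH].
    have -> : weak_box [::] = setT by apply/seteqP; split.
    by rewrite preimage_setT setIT; exact: measurable_horizon.
  rewrite (_ : _ `&` _ = (horizon t1 `&` (fun t => avg (sigma t) (mcshane i)) @^-1`
      `]ratr a, ratr b[) `&` (horizon t1 `&` sigma @^-1` (weak_box l))).
    apply: measurableI => //.
    by apply: (msigma _ (@Cmc i)) => //; exact: measurable_itv.
  apply/seteqP; split=> t /=.
    move=> [Ht lt]; split; split => //.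
      by have := lt _ (mem_head _ _); rewrite /= in_itv.
    by move=> x xl; apply: lt; rewrite inE xl orbT.
  move=> [[Ht it] [_ lt]]; split => // x; rewrite inE => /predU1P[->/=|/lt//].
  by move: it; rewrite in_itv.
apply: smallest_sub.
  split => [|B mB|B mB].
  - by rewrite /M/= preimage_set0 setI0.
  - rewrite /M/= setTD preimage_setC.
    rewrite (_ : _ `&` _ = horizon t1 `\` (horizon t1 `&` sigma @^-1` B)).
      by apply: measurableD => //; exact: measurable_horizon.
    by rewrite setDIr setDv set0U setDE.
  - rewrite /M/= preimage_bigcup setI_bigcupr.
    exact: bigcupT_measurable.
move=> B oB; rewrite /M /= (_ : B = \bigcup_(l in [set l | weak_box l `<=` B]) weak_box l).
  rewrite preimage_bigcup setI_bigcupr bigcup_mkcond.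
  apply: countable_bigcupT_measurable => [|l]; first exact: countableP.
  by case: ifP => _; [exact: mbox|exact: measurable0].
apply/seteqP; split=> [P BP|P [l /= lB lP]]; last exact: lB.
by have [l lP lB] := weak_box_base oB BP; exists l.
Qed.

End CountableBase.

(** * Integrands continuous in time, and convergence of controls *)

Section WithinComposition.
Context {X Y Z : topologicalType}.

Lemma within_continuous_comp (K : set X) (D : set Y) (h : X -> Y) (F : Y -> Z) :
  {within D, continuous F} -> {within K, continuous h} -> (forall x, K x -> D (h x)) ->
  {within K, continuous (F \o h)}.
Proof.
move=> cF ch KD; apply/subspace_continuousP => x Kx W /= FW.
have /subspace_continuousP/(_ (h x) (KD x Kx) W FW) := cF.
have /subspace_continuousP/(_ x Kx) := ch => /[apply].
apply: (@filterS _ (nbhs x)) => x' /= DW Kx'.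
by apply: DW => //; exact: KD.
Qed.

Lemma within_continuous_pair (K : set X) (f : X -> Y) (g : X -> Z) :
  {within K, continuous f} -> {within K, continuous g} ->
  {within K, continuous (fun x => (f x, g x))}.
Proof.
move=> cf cg; apply/subspace_continuousP => x Kx.
have /subspace_continuousP/(_ x Kx) fx := cf.
have /subspace_continuousP/(_ x Kx) gx := cg.
exact: cvg_pair fx gx.
Qed.

End WithinComposition.

Lemma within_continuous_fst (X Y : topologicalType) (K : set (X * Y)) :
  {within K, continuous (fun z => z.1)}.
Proof. by apply: continuous_subspaceT => z; exact: cvg_fst. Qed.

Lemma within_continuous_snd (X Y : topologicalType) (K : set (X * Y)) :
  {within K, continuous (fun z => z.2)}.
Proof. by apply: continuous_subspaceT => z; exact: cvg_snd. Qed.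

Section TimeContinuous.
Context {R : realType} {p : nat} (t1 : R) (U : set 'rV[R]_p).
Hypothesis t1_gt0 : 0 < t1.
Hypothesis U_compact : compact U.
Implicit Types (g : R -> 'rV[R]_p -> R) (phi : 'rV[R]_p -> R).
Local Notation C phi := {within U, continuous phi}.
Local Notation H := (horizon t1).

Let mH : measurable (H : set (lebesgueR R)) := measurable_horizon t1.
Let muH : (leb R H < +oo)%E := leb_horizon_lty t1.

(** Continuity of s |-> g s from the horizon into C(U) with the uniform norm, in
    its uniform form. *)
Record time_continuous g : Prop := TimeContinuous {
  time_continuous_at : forall s, H s -> C (g s) ;
  time_continuous_unif : forall e, 0 < e -> exists2 d, 0 < d &
    forall s s', H s -> H s' -> `|s - s'| < d ->
      forall u, U u -> `|g s u - g s' u| <= e }.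

(** The path can be substituted into F before the compactness argument, which
    then takes place on the product of the horizon with U only. *)
Lemma joint_time_continuous (n : nat) (F : R -> 'rV[R]_n -> 'rV[R]_p -> R)
    (x : R -> 'rV[R]_n) :
  {within [set z : R * 'rV[R]_n * 'rV[R]_p | H z.1.1 /\ U z.2],
    continuous (fun z => F z.1.1 z.1.2 z.2)} ->
  {within H, continuous x} ->
  time_continuous (fun s => F s (x s)).
Proof.
set D := [set z | _] => cF cx.
pose K := [set z : R * 'rV[R]_p | H z.1 /\ U z.2].
have cK : compact K by apply: compact_setX => //; exact: segment_compact.
have cFh : {within K, continuous (fun z => F z.1 (x z.1) z.2)}.
  apply: (within_continuous_comp (h := fun z => (z.1, x z.1, z.2)) cF) => //.
  apply: within_continuous_pair; last exact: within_continuous_snd.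
  apply: within_continuous_pair; first exact: within_continuous_fst.
  apply: (within_continuous_comp cx); first exact: within_continuous_fst.
  by move=> z [].
split.
- move=> s Hs; apply: (within_continuous_comp (h := fun u => (s, u)) cFh) => //.
  apply: within_continuous_pair; last by apply: continuous_subspaceT => u; exact: cvg_id.
  by apply: continuous_subspaceT; exact: cst_continuous.
- move=> e e0; have [d d0 dK] := heine_cantor cK cFh e0.
  exists d => // s s' Hs Hs' ss' u Uu; apply/ltW.
  apply: (dK (s, u) (s', u)) => //; split => //=; last exact: ballxx.
Qed.

Definition grid_cell (h : R) (i : nat) : set R := `[i%:R * h, i.+1%:R * h[%classic.
(** The truncation keeps in the horizon the left end of the cells that lie
    beyond it. *)
Definition grid_point (h : R) (i : nat) : R := Num.min (i%:R * h) t1.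

Lemma grid_cellE h i s : 0 < h -> 0 <= s ->
  grid_cell h i s <-> i = Num.truncn (s / h).
Proof.
move=> h0 s0; rewrite /grid_cell/= in_itv/= -ler_pdivlMr// -ltr_pdivrMr//.
rewrite -truncn_eq ?divr_ge0 ?(ltW h0)//.
by split => [/eqP <-|->].
Qed.

Lemma grid_point_horizon h i : 0 < h -> H (grid_point h i).
Proof.
move=> h0; rewrite /horizon/= in_itv/= le_min mulr_ge0 ?(ltW h0) ?(ltW t1_gt0)//=.
by rewrite ge_min lexx orbT.
Qed.

Lemma grid_index_lt h N s : 0 < h -> H s -> t1 < N%:R * h ->
  (Num.truncn (s / h) < N)%N.
Proof.
move=> h0; rewrite /horizon/= in_itv/= => /andP[s0 st] t1N.
rewrite -(ltr_nat R); apply: (@le_lt_trans _ _ (s / h)).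
  by rewrite truncn_le// divr_ge0// ltW.
by rewrite ltr_pdivrMr// (le_lt_trans st).
Qed.

Lemma grid_point_near h s : 0 < h -> H s ->
  `|s - grid_point h (Num.truncn (s / h))| < h.
Proof.
move=> h0; rewrite /horizon/= in_itv/= => /andP[s0 st].
have : grid_cell h (Num.truncn (s / h)) s by apply/grid_cellE.
rewrite /grid_cell/= in_itv/= => /andP[s1 s2].
rewrite /grid_point min_l ?(le_trans s1)//.
rewrite ger0_norm ?subr_ge0//; move: s2; rewrite -natr1 mulrDl mul1r; lra.
Qed.

Lemma grid_sum h N s (a : nat -> R) : 0 < h -> H s -> t1 < N%:R * h ->
  \sum_(i < N) \1_(grid_cell h i) s * a i = a (Num.truncn (s / h)).
Proof.
move=> h0 Hs t1N; have iN := grid_index_lt h0 Hs t1N.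
have s0 : 0 <= s by move: Hs; rewrite /horizon/= in_itv/= => /andP[].
rewrite (bigD1 (Ordinal iN))//= big1 ?addr0; last first.
  move=> j ji; rewrite indicE memNset ?mul0r// => /grid_cellE jE.
  by move/eqP: ji; apply; apply/val_inj => /=; rewrite jE.
by rewrite indicE mem_set ?mul1r//; apply/grid_cellE.
Qed.

Lemma time_continuous_step g e : time_continuous g -> 0 < e ->
  exists h N, 0 < h /\ forall s, H s -> forall P : PU U,
    `|avg P (g s) - \sum_(i < N) \1_(grid_cell h i) s * avg P (g (grid_point h i))| <= e.
Proof.
move=> gc e0; have [d d0 dg] := time_continuous_unif gc e0.
exists d, (Num.truncn (t1 / d)).+1; split=> // s Hs P.
rewrite (grid_sum (fun i => avg P (g (grid_point d i))))//; last first.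
  by rewrite -ltr_pdivrMr// truncnS_gt.
apply: normr_avgB_le => //; try exact: (time_continuous_at gc).
  by apply: (time_continuous_at gc); exact: grid_point_horizon.
by apply: dg => //; [exact: grid_point_horizon|exact: grid_point_near].
Qed.

Lemma time_continuous_bounded g : time_continuous g ->
  exists2 M, 0 <= M & forall s u, H s -> U u -> `|g s u| <= M.
Proof.
move=> gc; have [d d0 dg] := time_continuous_unif gc ltr01.
have /choice[M MP] i : exists M, forall u, U u -> `|g (grid_point d i) u| <= M.
  apply: continuous_bounded => //; apply: (time_continuous_at gc).
  exact: grid_point_horizon.
pose N := (Num.truncn (t1 / d)).+1.
exists (1 + \sum_(i < N) `|M i|) => [|s u Hs Uu]; first by rewrite addr_ge0 ?sumr_ge0.
pose j := Num.truncn (s / d).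
have jN : (j < N)%N by apply: grid_index_lt => //; rewrite -ltr_pdivrMr// truncnS_gt.
have gj : `|g s u - g (grid_point d j) u| <= 1.
  by apply: dg => //; [exact: grid_point_horizon|exact: grid_point_near].
rewrite -[g s u](subrK (g (grid_point d j) u)) (le_trans (ler_normD _ _))// lerD//.
rewrite (le_trans (MP j u Uu))// (le_trans (ler_norm _))//.
by rewrite (bigD1 (Ordinal jN))//= lerDl sumr_ge0.
Qed.

Section ControlledAverages.
Context (sigma : R -> PU U).
Hypothesis sigma_measurable : relaxed_controls t1 sigma.

Lemma measurable_avg_time g : time_continuous g ->
  measurable_fun (H : set (lebesgueR R)) (fun t : lebesgueR R => avg (sigma t) (g t)).
Proof.
move=> gc; have n0 n : 0 < n.+1%:R^-1 :> R by rewrite invr_gt0.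
have /choice[hN hNP] n : exists hN : R * nat, 0 < hN.1 /\ forall s, H s -> forall P : PU U,
    `|avg P (g s) - \sum_(i < hN.2) \1_(grid_cell hN.1 i) s *
       avg P (g (grid_point hN.1 i))| <= n.+1%:R^-1.
  by have [h [N hN]] := time_continuous_step gc (n0 n); exists (h, N).
apply: (@measurable_fun_cvg _ (lebesgueR R) R H (fun n s => \sum_(i < (hN n).2)
  \1_(grid_cell (hN n).1 i) s * avg (sigma s) (g (grid_point (hN n).1 i)))).
- move=> n; apply: measurable_sum => i; apply: measurable_funM.
    by apply: measurable_indic; apply: measurable_lebesgueR; exact: measurable_itv.
  apply: measurable_avg => //; apply: (time_continuous_at gc).
  by apply: grid_point_horizon; have [] := hNP n.
- move=> s Hs; apply/cvgrPdist_le => e e0; near=> n.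
  have [_ /(_ s Hs (sigma s)) h] := hNP n.
  rewrite (le_trans h)// ltW//; near: n; exact: (near_infty_natSinv_lt (PosNum e0)).
Unshelve. all: by end_near. Qed.

Lemma avg_time_bounded g : time_continuous g ->
  exists2 M, 0 <= M & forall s, H s -> `|avg (sigma s) (g s)| <= M.
Proof.
move=> gc; have [M M0 gM] := time_continuous_bounded gc; exists M => // s Hs.
by apply: normr_avg_le => //; [exact: (time_continuous_at gc)|move=> u; exact: gM].
Qed.

Lemma integrable_avg_time g (A : set R) : time_continuous g -> measurable A ->
  (leb R).-integrable (H `&` A) (fun s => (avg (sigma s) (g s))%:E).
Proof.
move=> gc mA; apply: (@integrableS _ (lebesgueR R) R (leb R) H) => //.
- by apply: measurableI => //; exact: measurable_lebesgueR.
- have [M _ gM] := avg_time_bounded gc.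
  exact: (bounded_integrable (mu := leb R) (measurable_horizon t1)
    (leb_horizon_lty t1) (measurable_avg_time gc) gM).
Qed.

End ControlledAverages.

(** These products of a function of time and a function on U are just enough to
    reach, by approximation, the integrands of [control_cvg_time]. The filter is
    arbitrary in order to cover both sequences and ultrafilters. *)
Definition control_cvg (F : set_system nat) (sigma_ : nat -> R -> PU U) (sigma : R -> PU U) :=
  forall (A : set R) phi, measurable A -> C phi ->
    \int[leb R]_(t in H `&` A) avg (sigma_ k t) phi @[k --> F] -->
    \int[leb R]_(t in H `&` A) avg (sigma t) phi.

(** The step approximation of g is uniform over all controls, and the integral of
    a step function is a finite sum of the quantities whose convergence is
    assumed. *)
Lemma control_cvg_time (F : set_system nat) {FF : ProperFilter F} sigma_ sigma g (A : set R) :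
  (forall k, relaxed_controls t1 (sigma_ k)) -> relaxed_controls t1 sigma ->
  control_cvg F sigma_ sigma -> time_continuous g -> measurable A ->
  \int[leb R]_(t in H `&` A) avg (sigma_ k t) (g t) @[k --> F] -->
  \int[leb R]_(t in H `&` A) avg (sigma t) (g t).
Proof.
move=> ms_ ms cs gc mA; apply/cvgrPdist_le => e e0.
have arith (a b c d : R) : `|c - d| <= e / 3 -> `|a - c| <= e / 3 -> `|b - d| <= e / 3 ->
    `|a - b| <= e.
  rewrite !ler_norml => /andP[? ?] /andP[? ?] /andP[? ?].
  by apply/andP; split; lra.
pose d := e / (3 * (t1 + 1)).
have d0 : 0 < d by rewrite divr_gt0// mulr_gt0// addr_gt0.
have [h [N [h0 hP]]] := time_continuous_step gc d0.
have mHA : measurable (H `&` A : set (lebesgueR R)).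
  by apply: measurableI => //; exact: measurable_lebesgueR.
have Cg i : C (g (grid_point h i)).
  by apply: (time_continuous_at gc); exact: grid_point_horizon.
pose S (s : R -> PU U) := \int[leb R]_(t in H `&` A)
  \sum_(i < N) \1_(grid_cell h i) t * avg (s t) (g (grid_point h i)).
have muHA : (leb R (H `&` A) <= t1%:E)%E.
  rewrite -(leb_horizon (ltW t1_gt0)); apply: le_measure => //; rewrite inE//.
have muHAy : (leb R (H `&` A) < +oo)%E by rewrite (le_lt_trans muHA)// ltry.
have mterm (s : R -> PU U) i : relaxed_controls t1 s -> measurable_fun (H `&` A : set (lebesgueR R))
    (fun t : lebesgueR R => \1_(grid_cell h i) t * avg (s t) (g (grid_point h i))).
  move=> mS; apply: measurable_funM.
    by apply: measurable_indic; apply: measurable_lebesgueR; exact: measurable_itv.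
  exact: measurable_funS mH (@subIsetl _ _ _) (measurable_avg U_compact mS (@Cg i)).
have iterm (s : R -> PU U) i : relaxed_controls t1 s -> (leb R).-integrable (H `&` A)
    (EFin \o (fun t => \1_(grid_cell h i) t * avg (s t) (g (grid_point h i)))).
  move=> mS; have [M gM] := continuous_bounded U_compact (Cg i).
  apply: (bounded_integrable (mu := leb R) (M := M) mHA muHAy (mterm s i mS)).
  move=> t [Ht _]; have := normr_avg_le U_compact (s t) (@Cg i) gM.
  rewrite normrM indicE; case: (_ \in _); first by rewrite normr1 mul1r.
  by rewrite normr0 mul0r; exact: le_trans.
have closeS (s : R -> PU U) : relaxed_controls t1 s ->
    `|\int[leb R]_(t in H `&` A) avg (s t) (g t) - S s| <= e / 3.
  move=> mS; rewrite /S -RintegralB//; last 2 first.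
  - exact: integrable_avg_time.
  - by apply: (integrable_Rsum (mu := leb R) _ mHA) => i; exact: iterm.
  apply: (@le_trans _ _ (d * fine (leb R (H `&` A)))).
    apply: (normr_Rintegral_le (mu := leb R) mHA muHAy); last first.
      by move=> t [Ht _]; exact: hP.
    apply: measurable_funB.
      exact: measurable_funS mH (@subIsetl _ _ _) (measurable_avg_time mS gc).
    by apply: measurable_sum => i; exact: mterm.
  apply: (@le_trans _ _ (d * t1)).
    rewrite ler_wpM2l ?(ltW d0)// -lee_fin fineK//.
    by rewrite ge0_fin_numE.
  have dE : d * (3 * (t1 + 1)) = e by rewrite divfK// gt_eqF// mulr_gt0// addr_gt0.
  by move: dE d0; lra.
have cvgS : S (sigma_ k) @[k --> F] --> S sigma.
  have SE (s : R -> PU U) : relaxed_controls t1 s -> S s = \sum_(i < N)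
      \int[leb R]_(t in H `&` (A `&` grid_cell h i)) avg (s t) (g (grid_point h i)).
    move=> mS; rewrite /S Rintegral_sum//; last by move=> i; exact: iterm.
    by apply: eq_bigr => i _; rewrite Rintegral_indic_restr setIA.
  rewrite SE//; under eq_fun do rewrite SE//.
  apply: cvg_big => [|i _]; first exact: add_continuous.
  apply: cs => //.
  by apply: measurableI => //; exact: measurable_itv.
have e30 : 0 < e / 3 by rewrite divr_gt0.
move/cvgrPdist_le/(_ _ e30) : cvgS; apply: filterS => k Sk.
exact: arith Sk (closeS _ ms) (closeS _ (ms_ k)).
Qed.

End TimeContinuous.

(** * Primitives and the exponential weight *)

Section Primitive.
Context {R : realType} (t1 : R).
Local Notation H := (horizon t1).

Lemma horizonP t : H t <-> 0 <= t <= t1.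
Proof. by rewrite /horizon/= in_itv. Qed.

Let mH : measurable (H : set (lebesgueR R)) := measurable_horizon t1.

Lemma bounded_integrable_horizon (h : R -> R) M :
  measurable_fun (H : set (lebesgueR R)) (h : lebesgueR R -> R) ->
  (forall s, H s -> `|h s| <= M) -> (leb R).-integrable H (EFin \o h).
Proof. exact: (bounded_integrable (mu := leb R) mH (leb_horizon_lty t1)). Qed.

Lemma primitive_lipschitz (h : R -> R) M a b :
  measurable_fun (H : set (lebesgueR R)) (h : lebesgueR R -> R) ->
  (forall s, H s -> `|h s| <= M) -> H a -> H b ->
  `|\int[leb R]_(s in horizon a) h s - \int[leb R]_(s in horizon b) h s|
    <= M * `|a - b|.
Proof.
move=> mh hM; wlog ab : a b / a <= b => [wl Ha Hb|].
  have [/wl|/ltW/wl] := leP a b; first exact.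
  by rewrite distrC (distrC a); apply.
move=> /horizonP/andP[a0 a1] /horizonP/andP[b0 b1].
have mba : measurable (`]a, b]%classic : set (lebesgueR R)).
  by apply: measurable_lebesgueR; exact: measurable_itv.
have baE : horizon b = horizon a `|` `]a, b]%classic.
  by rewrite /horizon; apply: itv_bndbnd_setU; rewrite bnd_simp.
have baH : `]a, b]%classic `<=` H.
  move=> s; rewrite /= in_itv/= => /andP[/ltW sa sb]; apply/horizonP.
  by rewrite (le_trans a0)// (le_trans sb).
have mhba : measurable_fun (`]a, b]%classic : set (lebesgueR R)) (h : lebesgueR R -> R).
  exact: measurable_funS mH baH mh.
have leb_ba : leb R `]a, b]%classic = (b - a)%:E.
  rewrite [LHS](_ : _ = lebesgue_measure (`]a, b]%classic : set R))//.
  rewrite lebesgue_measure_itv/= lte_fin -EFinB.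
  by case: ltgtP ab => // -> _; rewrite subrr.
have ih : (leb R).-integrable (horizon b) (EFin \o h).
  apply: (@integrableS _ (lebesgueR R) R (leb R) H) => //.
  - exact: measurable_horizon.
  - exact: horizon_sub.
  - exact: bounded_integrable_horizon hM.
rewrite baE Rintegral_setU//; last 3 first.
- exact: measurable_horizon.
- by rewrite -baE.
- apply/disj_setPS => s [/=]; rewrite /horizon/= !in_itv/= => /andP[_ sa] /andP[].
  by rewrite ltNge sa.
rewrite opprD addNKr normrN (ler0_norm (x := a - b)) ?subr_le0// opprB.
have -> : b - a = fine (leb R `]a, b]%classic) by rewrite leb_ba.
have ba_lty : (leb R `]a, b]%classic < +oo)%E by rewrite leb_ba ltry.
apply: (normr_Rintegral_le (mu := leb R) mba ba_lty mhba).
by move=> s /baH; exact: hM.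
Qed.

Lemma measurable_weight (K : R) (A : set R) :
  measurable_fun A (fun s : R => K * expR (2 * K * s)).
Proof.
apply: measurable_funTS; apply: measurable_funM => //.
by apply: measurableT_comp => //.
Qed.

(** The weight [expR (2 * K * s)] turns the Volterra operator of Lipschitz
    constant K into a contraction of factor 1/2. *)
Lemma integral_weight (K t : R) : 0 <= t ->
  \int[leb R]_(s in horizon t) (K * expR (2 * K * s)) = (expR (2 * K * t) - 1) / 2.
Proof.
have dF (x : R) : is_derive x 1 (fun s => expR (2 * K * s) / 2) (K * expR (2 * K * x)).
  apply: is_derive_eq; rewrite scaler0 scaler0 add0r /GRing.scale/= mulr1.
  by field.
have cf : continuous (fun s : R => K * expR (2 * K * s)).
  by move=> x; apply: differentiable_continuous; apply/derivable1_diffP; exact: ex_derive.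
have cF : continuous (fun s : R => expR (2 * K * s) / 2).
  by move=> x; apply: differentiable_continuous; apply/derivable1_diffP; case: (dF x).
rewrite le_eqVlt /horizon => /predU1P[<-|t0];
  rewrite (Rintegral_lebesgueR (measurable_itv _) (@measurable_weight K _)).
- by rewrite mulr0 expR0 subrr mul0r set_itv1 Rintegral_set1.
- rewrite /Rintegral (@continuous_FTC2 _ _ (fun s => expR (2 * K * s) / 2) 0 t)//.
  + by rewrite -EFinB/= mulr0 expR0 mulrBl.
  + exact: continuous_subspaceT.
  + split; first by move=> x _; case: (dF x).
      by apply: cvg_at_right_filter; exact: cF.
    by apply: cvg_at_left_filter; exact: cF.
  + by move=> x _; rewrite derive1E; apply: derive_val.
Qed.

Lemma weighted_integral_le (h : R -> R) K c t : 0 < K -> H t ->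
  measurable_fun (H : set (lebesgueR R)) (h : lebesgueR R -> R) ->
  (forall s, H s -> `|h s| <= K * (c * expR (2 * K * s))) ->
  `|\int[leb R]_(s in horizon t) h s| <= c * (expR (2 * K * t) - 1) / 2.
Proof.
move=> K0 Ht mh hw; have /horizonP/andP[t0 tt1] := Ht.
have mt := measurable_horizon t.
have tH : horizon t `<=` H by exact: horizon_sub.
have c0 : 0 <= c.
  have := hw t Ht; have := normr_ge0 (h t); move=> /le_trans/[apply].
  by rewrite pmulr_rge0// pmulr_lge0// expR_gt0.
have wle s : H s -> expR (2 * K * s) <= expR (2 * K * t1).
  move=> /horizonP/andP[_ st]; rewrite ler_expR ler_wpM2l// mulr_ge0// ltW//.
have mexp : measurable_fun (horizon t : set (lebesgueR R)) (fun s : lebesgueR R => K * expR (2 * K * s)).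
  by apply: measurable_fun_lebesgueR; [exact: measurable_itv|exact: measurable_weight].
have iw : (leb R).-integrable (horizon t) (EFin \o (fun s => K * expR (2 * K * s))).
  apply: (bounded_integrable (mu := leb R) (M := K * expR (2 * K * t1)) mt (leb_horizon_lty t) mexp).
  move=> s /tH Hs; rewrite ger0_norm ?mulr_ge0 ?expR_ge0 ?(ltW K0)//.
  by rewrite ler_wpM2l ?(ltW K0)// wle.
have mht : measurable_fun (horizon t : set (lebesgueR R)) (h : lebesgueR R -> R).
  exact: measurable_funS mH tH mh.
have ht s : horizon t s -> `|h s| <= K * (c * expR (2 * K * t1)).
  move=> /tH Hs; apply: (le_trans (hw s Hs)).
  by rewrite ler_wpM2l ?(ltW K0)// ler_wpM2l// wle.
have ih := bounded_integrable (mu := leb R) mt (leb_horizon_lty t) mht ht.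
apply: (le_trans (le_normr_Rintegral mt ih)).
rewrite -mulrA -(integral_weight K t0) -RintegralZl//.
apply: (le_Rintegral (mu := leb R) mt).
- exact: integrable_norm ih.
- exact: (integrableZl (mu := leb R) mt c iw).
- by move=> s /tH Hs; rewrite mulrCA hw.
Qed.

End Primitive.

(** * Norms and geometric sequences of row vectors *)

Section RowVectors.
Context {R : realType} {n : nat}.
Implicit Types v : 'rV[R]_n.

Lemma normr_coord_le v i : `|v ord0 i| <= `|v|.
Proof.
rewrite [leRHS]/Num.norm/= mx_normrE; apply/bigmax_geP; right => /=.
by exists (ord0, i).
Qed.

Lemma normr_rV_le v c : 0 <= c -> (forall i, `|v ord0 i| <= c) -> `|v| <= c.
Proof.
move=> c0 vc; rewrite [leLHS]/Num.norm/= mx_normrE; apply/bigmax_leP.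
by split=> // -[i j] _ /=; rewrite (ord1 i).
Qed.

Lemma enorm_ge_coord v i : `|v ord0 i| <= enorm v.
Proof.
rewrite /enorm -sqrtr_sqr ler_wsqrtr// (bigD1 i)//= lerDl sumr_ge0// => j _.
exact: sqr_ge0.
Qed.

Lemma enorm_le_norm v : enorm v <= Num.sqrt n%:R * `|v|.
Proof.
rewrite /enorm -[X in _ * X](ger0_norm (normr_ge0 v)) -sqrtr_sqr -sqrtrM ?ler0n//.
rewrite ler_wsqrtr// mulr_natl.
have -> : `|v| ^+ 2 *+ n = \sum_(i < n) `|v| ^+ 2 by rewrite sumr_const card_ord.
apply: ler_sum => i _; rewrite -[leLHS]real_normK ?num_real// ler_sqr ?nnegrE//.
exact: normr_coord_le.
Qed.

End RowVectors.

Lemma geometric_cvg0 (R : realType) (c : R) : (fun m => c / 2 ^+ m) @ \oo --> (0 : R).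
Proof.
rewrite (_ : (fun m => _) = geometric c 2^-1).
  by apply: cvg_geometric; rewrite ger0_norm ?invr_ge0// invf_lt1// ltr1n.
by apply/funext => m; rewrite /geometric/= exprVn.
Qed.

Lemma geometric_small (R : realType) (c e : R) : 0 < e -> exists m, c / 2 ^+ m < e.
Proof.
move=> e0; have /cvgrPdist_lt/(_ e e0)[m _ /(_ m (leqnn m))] := geometric_cvg0 c.
by rewrite sub0r normrN => /(le_lt_trans (ler_norm _)); exists m.
Qed.

(** The increments after m sum to at most [2 * c / 2 ^+ m]; the explicit rate
    makes the limit uniform when u depends on a parameter. *)
Lemma geometric_limit (R : realType) (n : nat) (u : nat -> 'rV[R]_n) (c : R) :
  (forall m, `|u m.+1 - u m| <= c / 2 ^+ m) ->
  exists l, forall m, `|l - u m| <= 2 * c / 2 ^+ m.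
Proof.
move=> uc.
have p2 m : 0 < 2 ^+ m :> R by rewrite exprn_gt0.
have step m k : `|u (m + k)%N - u m| <= 2 * c / 2 ^+ m - 2 * c / 2 ^+ (m + k).
  elim: k => [|k IH]; first by rewrite addn0 !subrr normr0.
  rewrite addnS -(subrKA (u (m + k)%N)) (le_trans (ler_normD _ _))//.
  have := uc (m + k)%N; move: IH.
  have -> : 2 * c / 2 ^+ (m + k).+1 = c / 2 ^+ (m + k) :> R.
    by rewrite exprS; field; rewrite expf_neq0.
  have -> : 2 * c / 2 ^+ (m + k) = 2 * (c / 2 ^+ (m + k)) by rewrite mulrA.
  lra.
have c0 : 0 <= c by have := uc 0%N; rewrite expr0 divr1; apply: le_trans.
have bound m k : (m <= k)%N -> `|u k - u m| <= 2 * c / 2 ^+ m.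
  move=> mk; have := step m (k - m)%N; rewrite subnKC// => /le_trans; apply.
  by rewrite gerBl divr_ge0 ?mulr_ge0// ltW.
have : cvg (u @ \oo).
  apply/cauchy_cvgP/cauchy_exP => e e0.
  have [m um] := geometric_small (2 * c) e0; exists (u m); exists m => // k /= mk.
  by rewrite -ball_normE/= distrC (le_lt_trans (bound _ _ mk)).
move=> /cvg_ex[l ul]; exists l => m.
have : (fun k => `|u k - u m|) @ \oo --> `|l - u m|.
  by apply: cvg_norm; apply: cvgB => //; exact: cvg_cst.
move=> /cvgr_to_le; apply.
by exists m => // k; exact: bound.
Qed.

(** * Existence and stability of trajectories *)

Section Trajectories.
Context {R : realType} {n p : nat} (t1 : R) (U : set 'rV[R]_p)
  (f : R -> 'rV[R]_n -> 'rV[R]_p -> 'rV[R]_n) (K : R).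
Local Notation H := (horizon t1).
Local Notation w s := (expR (2 * K * s)).
Hypothesis t1_gt0 : 0 < t1.
Hypothesis U_compact : compact U.
Hypothesis K_gt0 : 0 < K.
Hypothesis f_time : forall x : R -> 'rV[R]_n, {within H, continuous x} ->
  forall i, time_continuous t1 U (fun s u => f s (x s) u ord0 i).
Hypothesis f_lip : forall s u z z' i, H s -> U u ->
  `|f s z u ord0 i - f s z' u ord0 i| <= K * `|z - z'|.
Implicit Types (x y : R -> 'rV[R]_n) (z : 'rV[R]_n).

Let mH : measurable (H : set (lebesgueR R)) := measurable_horizon t1.

Lemma weight_ge1 s : H s -> 1 <= w s.
Proof.
by move=> /horizonP/andP[s0 _]; rewrite -expR0 ler_expR !mulr_ge0// ltW.
Qed.

Lemma weight_le s : H s -> w s <= w t1.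
Proof.
by move=> /horizonP/andP[_ st]; rewrite ler_expR ler_wpM2l// mulr_ge0// ltW.
Qed.

Section OneControl.
Context (sigma : R -> PU U).
Hypothesis sigma_measurable : relaxed_controls t1 sigma.

Definition velocity x i (s : R) : R := relaxed_field f s (x s) (sigma s) ord0 i.

Let velocityE x i s : velocity x i s = avg (sigma s) (fun u => f s (x s) u ord0 i).
Proof. by rewrite /velocity /relaxed_field mxE. Qed.

Lemma measurable_velocity x i : {within H, continuous x} ->
  measurable_fun (H : set (lebesgueR R)) (velocity x i : lebesgueR R -> R).
Proof.
move=> cx; rewrite (_ : velocity x i = fun s => avg (sigma s) (fun u => f s (x s) u ord0 i)).
  exact: (measurable_avg_time t1_gt0 U_compact sigma_measurable (f_time cx i)).
by apply/funext => s; exact: velocityE.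
Qed.

Lemma velocity_bounded x : {within H, continuous x} ->
  exists2 M, 0 <= M & forall i s, H s -> `|velocity x i s| <= M.
Proof.
move=> cx; have /choice[M MP] i : exists M, forall s, H s -> `|velocity x i s| <= M.
  have [M _ HM] := avg_time_bounded t1_gt0 U_compact sigma (f_time cx i).
  by exists M => s Hs; rewrite velocityE; exact: HM.
exists (\sum_i `|M i|) => [|i s Hs]; first exact: sumr_ge0.
rewrite (le_trans (MP i s Hs))// (le_trans (ler_norm _))// (bigD1 i)//= lerDl.
exact: sumr_ge0.
Qed.

Lemma velocity_lip x y i s : {within H, continuous x} -> {within H, continuous y} ->
  H s -> `|velocity x i s - velocity y i s| <= K * `|x s - y s|.
Proof.
move=> cx cy Hs; rewrite !velocityE; apply: normr_avgB_le => //.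
- exact: time_continuous_at (f_time cx i) _ Hs.
- exact: time_continuous_at (f_time cy i) _ Hs.
- by move=> u Uu; exact: f_lip.
Qed.

Definition picard z x (t : R) : 'rV[R]_n :=
  \row_i (z ord0 i + \int[leb R]_(s in horizon t) velocity x i s).

Lemma picard_continuous z x : {within H, continuous x} -> {within H, continuous (picard z x)}.
Proof.
move=> cx; have [M M0 vM] := velocity_bounded cx.
apply/subspace_continuousP => t Ht.
apply/(@cvgrPdist_le _ _ _ (within H (nbhs t))) => e e0.
pose d := e / (M + 1); have M10 : 0 < M + 1 by rewrite ltr_pwDr.
have d0 : 0 < d by rewrite divr_gt0.
rewrite near_withinE; apply: filterS (nbhsx_ballx t d d0) => s.
rewrite -ball_normE/= => ts Hs; apply: normr_rV_le; first exact: ltW.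
move=> i; rewrite !mxE opprD addrACA subrr add0r.
apply: le_trans (primitive_lipschitz (measurable_velocity i cx) (vM i) Ht Hs) _.
apply: (@le_trans _ _ (M * d)); first by rewrite ler_wpM2l// ltW.
by rewrite /d mulrA ler_pdivrMr// mulrC ler_wpM2l ?(ltW e0)// lerDl.
Qed.

(** Each coordinate is treated separately and the maximum norm recombines them,
    so the factor 1/2 does not depend on the dimension. *)
Lemma picard_contraction z x y c t :
  {within H, continuous x} -> {within H, continuous y} -> H t ->
  (forall s, H s -> `|x s - y s| <= c * w s) ->
  `|picard z x t - picard z y t| <= c * (w t - 1) / 2.
Proof.
move=> cx cy Ht xy; have /horizonP/andP[t0 tt1] := Ht.
have c0 : 0 <= c.
  have := xy t Ht; have := normr_ge0 (x t - y t); move=> /le_trans/[apply].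
  by rewrite pmulr_lge0// expR_gt0.
have wt : 0 <= w t - 1 by rewrite subr_ge0 weight_ge1.
apply: normr_rV_le; first by rewrite mulr_ge0// mulr_ge0.
move=> i; rewrite !mxE opprD addrACA subrr add0r.
have mt := measurable_horizon t.
have int_v v : {within H, continuous v} -> (leb R).-integrable (horizon t) (EFin \o velocity v i).
  move=> cv; have [M M0 vM] := velocity_bounded cv.
  apply: (@integrableS _ (lebesgueR R) R (leb R) H) => //.
  - exact: horizon_sub.
  - exact: bounded_integrable_horizon (measurable_velocity i cv) (vM i).
rewrite -(RintegralB (mu := leb R) mt (int_v x cx) (int_v y cy)).
apply: (weighted_integral_le K_gt0 Ht).
  apply: measurable_funB; exact: measurable_velocity.
move=> s Hs; apply: le_trans (velocity_lip i cx cy Hs) _.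
by rewrite ler_wpM2l ?(ltW K_gt0)// xy.
Qed.

Lemma picard_trajectory z x : {within H, continuous x} ->
  (forall t, H t -> x t = picard z x t) -> is_trajectory t1 f sigma z x.
Proof.
move=> cx xE; split => // i; split.
  have [M M0 vM] := velocity_bounded cx.
  exact: bounded_integrable_horizon (measurable_velocity i cx) (vM i).
by move=> t Ht; rewrite {1}xE// mxE.
Qed.

Lemma trajectory_picard z x : is_trajectory t1 f sigma z x ->
  forall t, H t -> x t = picard z x t.
Proof.
by move=> [_ xE] t Ht; apply/rowP => i; rewrite mxE; have [_ ->] := xE i.
Qed.

Lemma continuous_norm_bounded x : {within H, continuous x} ->
  exists2 D, 0 <= D & forall s, H s -> `|x s| <= D.
Proof.
move=> cx; have cH : compact H by exact: segment_compact.
have /compact_bounded[D [_ xD]] := continuous_compact cx cH.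
exists (`|D| + 1) => [|s Hs]; first by rewrite addr_ge0.
by apply: xD; [rewrite (le_lt_trans (ler_norm D))// ltrDl|exists s].
Qed.

(** Picard iteration from the constant path. By [picard_contraction] the
    increments decrease geometrically in the weighted norm, uniformly on the whole
    horizon, so that no restriction to short time intervals is needed. *)
Lemma trajectory_exists z : exists x, is_trajectory t1 f sigma z x.
Proof.
have arith (a b c v v1 e' : R) : c * (1 + v1) < e' -> a <= c / 2 ->
  b <= c * (v - 1) / 2 -> c * v <= c * v1 -> 0 <= c -> 0 <= c * v1 -> a + b <= e' by lra.
pose X m := iter m (picard z) (fun=> z).
have cX m : {within H, continuous (X m)}.
  elim: m => [|m IH]; last exact: picard_continuous.
  by apply: continuous_subspaceT; exact: cst_continuous.
have [D D0 XD] : exists2 D, 0 <= D & forall s, H s -> `|X 1%N s - X 0%N s| <= D.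
  exact: continuous_norm_bounded (within_continuousB (cX 1%N) (cX 0%N)).
have Xstep m s : H s -> `|X m.+1 s - X m s| <= D / 2 ^+ m * w s.
  elim: m s => [|m IH] s Hs.
    by rewrite expr0 divr1 (le_trans (XD s Hs))// ler_peMr// weight_ge1.
  apply: le_trans (picard_contraction z (cX m.+1) (cX m) Hs IH) _.
  have -> : D / 2 ^+ m.+1 = D / 2 ^+ m / 2 by rewrite exprSr invfM mulrA.
  have : 0 <= D / 2 ^+ m by rewrite divr_ge0// exprn_ge0.
  lra.
pose r m := 2 * (D * w t1) / 2 ^+ m.
have r_ge0 m : 0 <= r m by rewrite divr_ge0 ?exprn_ge0// !mulr_ge0// expR_ge0.
have /choice[x xP] s : exists l, H s -> forall m, `|l - X m s| <= r m.
  have [Hs|nHs] := pselect (H s); last by exists z.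
  have [m|l lP] := @geometric_limit _ _ (X ^~ s) (D * w t1); last by exists l.
  apply: le_trans (Xstep m s Hs) _; rewrite mulrAC.
  by rewrite ler_wpM2r ?invr_ge0 ?exprn_ge0// ler_wpM2l// weight_le.
have cx : {within H, continuous x}.
  apply/subspace_continuousP => t Ht.
  apply/(@cvgrPdist_lt _ _ _ (within H (nbhs t))) => e e0.
  have e30 : 0 < e / 3 by rewrite divr_gt0.
  have [m rm] := geometric_small (2 * (D * w t1)) e30.
  have /subspace_continuousP/(_ t Ht) := cX m.
  move=> /(@cvgrPdist_lt _ _ _ (within H (nbhs t)))/(_ _ e30).
  rewrite !near_withinE; apply: (@filterS _ (nbhs t)) => s + Hs => /(_ Hs) Xts.
  rewrite -(subrKA (X m t)) -(subrKA (X m s) (X m t)).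
  rewrite (le_lt_trans (ler_normD _ _))// (le_lt_trans (lerD (lexx _) (ler_normD _ _)))//.
  have := xP t Ht m; have := xP s Hs m; rewrite (distrC (x s)) /r.
  move: rm Xts; lra.
exists x; apply: picard_trajectory => // t Ht.
suff : `|x t - picard z x t| <= 0 by rewrite normr_le0 subr_eq0 => /eqP.
apply/ler_addgt0Pr => e e0; rewrite add0r.
have [m rm] := geometric_small (2 * (D * w t1) * (1 + w t1)) e0.
apply: (@le_trans _ _ (`|x t - X m.+1 t| + `|X m.+1 t - picard z x t|)).
  exact: ler_distD.
have xX s : H s -> `|X m s - x s| <= r m * w s.
  by move=> Hs; rewrite distrC (le_trans (xP s Hs m))// ler_peMr// weight_ge1.
have rS : r m.+1 = r m / 2 by rewrite /r exprSr invfM !mulrA.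
have h1 := xP t Ht m.+1; have h2 := picard_contraction z (cX m) cx Ht xX.
have h3 := ler_wpM2l (r_ge0 m) (weight_le Ht); have h4 := r_ge0 m.
rewrite rS in h1; rewrite mulrAC -/(r m) in rm.
exact: arith rm h1 h2 h3 h4 (mulr_ge0 h4 (expR_ge0 _)).
Qed.

End OneControl.

Section Stability.
Context (F : set_system nat) {FF : ProperFilter F}.
Context (sigma_ : nat -> R -> PU U) (sigma : R -> PU U).
Hypothesis sigma__measurable : forall k, relaxed_controls t1 (sigma_ k).
Hypothesis sigma_measurable : relaxed_controls t1 sigma.
Hypothesis sigma_cvg : control_cvg t1 F sigma_ sigma.

(** The integrals up to t converge for each t and are Lipschitz in t with a
    common constant, so they converge uniformly. *)
Lemma velocity_integral_cvg x e : {within H, continuous x} -> 0 < e ->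
  \forall k \near F, forall t, H t -> forall i,
    `|\int[leb R]_(s in horizon t) velocity (sigma_ k) x i s -
      \int[leb R]_(s in horizon t) velocity sigma x i s| <= e.
Proof.
move=> cx e0.
have arith (b1 b2 b3 b4 : R) : `|b1 - b3| <= e / 4 -> `|b2 - b4| <= e / 4 ->
    `|b3 - b4| <= e / 2 -> `|b1 - b2| <= e.
  rewrite !ler_norml => /andP[? ?] /andP[? ?] /andP[? ?].
  by apply/andP; split; lra.
have /choice[M MP] i : exists M, forall s u, H s -> U u -> `|f s (x s) u ord0 i| <= M.
  by have [M _ fM] := time_continuous_bounded t1_gt0 U_compact (f_time cx i); exists M.
pose M0 := \sum_i `|M i|.
have vM (tau : R -> PU U) i s : H s -> `|velocity tau x i s| <= M0.
  move=> Hs; rewrite /velocity /relaxed_field mxE.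
  apply: (normr_avg_le U_compact).
    exact: time_continuous_at (f_time cx i) _ Hs.
  move=> u Uu; rewrite (le_trans (MP i s u Hs Uu))// (le_trans (ler_norm _))//.
  by rewrite /M0 (bigD1 i)//= lerDl sumr_ge0.
have M0_ge0 : 0 <= M0 by exact: sumr_ge0.
pose h := e / (4 * (M0 + 1)).
have h0 : 0 < h by rewrite divr_gt0// mulr_gt0// ltr_pwDr.
have hM : M0 * h <= e / 4.
  have : h * (4 * (M0 + 1)) = e by rewrite divfK// gt_eqF// mulr_gt0// ltr_pwDr.
  by move: h0; lra.
pose N := (Num.truncn (t1 / h)).+1.
pose gap k t i := \int[leb R]_(s in horizon t) velocity (sigma_ k) x i s -
      \int[leb R]_(s in horizon t) velocity sigma x i s.
have near_grid : \forall k \near F, forall ij : 'I_N * 'I_n,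
    `|gap k (grid_point t1 h ij.1) ij.2| <= e / 2.
  apply: filter_forall => -[j i]; rewrite /gap/=.
  set a := grid_point t1 h j; have Ha : H a by exact: grid_point_horizon.
  have HaE : H `&` horizon a = horizon a.
    by rewrite setIidr//; apply: horizon_sub; move: Ha => /horizonP/andP[].
  have := control_cvg_time t1_gt0 U_compact sigma__measurable sigma_measurable
    sigma_cvg (f_time cx i) (measurable_itv `[0, a]).
  rewrite -/(horizon a) HaE => /(_ FF)/cvgrPdist_le/(_ (e / 2)).
  rewrite divr_gt0// => /(_ isT); apply: filterS => k; rewrite distrC.
  have vE (tau : R -> PU U) : \int[leb R]_(s in horizon a) velocity tau x i s =
      \int[leb R]_(s in horizon a) avg (tau s) (fun u => f s (x s) u ord0 i).
    by apply: eq_Rintegral => s _; rewrite /velocity /relaxed_field mxE.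
  by rewrite !vE.
apply: filterS near_grid => k grid t Ht i.
pose j := Num.truncn (t / h).
have jN : (j < N)%N by apply: (grid_index_lt h0 Ht); rewrite -ltr_pdivrMr// truncnS_gt.
have := grid (Ordinal jN, i); rewrite /gap/=; set a := grid_point t1 h j => gap_a.
have Ha : H a by exact: grid_point_horizon.
have ta : `|t - a| <= h by apply/ltW/grid_point_near.
have lip tau : relaxed_controls t1 tau ->
    `|\int[leb R]_(s in horizon t) velocity tau x i s -
      \int[leb R]_(s in horizon a) velocity tau x i s| <= e / 4.
  move=> mtau; apply: le_trans hM.
  apply: le_trans (primitive_lipschitz (measurable_velocity mtau i cx) (vM tau i) Ht Ha) _.
  by rewrite ler_wpM2l.
exact: arith (lip _ (sigma__measurable k)) (lip _ sigma_measurable) gap_a.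
Qed.

(** Gronwall estimate: if the data differ by at most a, the weighted distance
    [sup_t |x t - y t| / w t] is at most [a] plus half of itself. *)
Lemma weighted_gronwall (tau : R -> PU U) z x y a : relaxed_controls t1 tau ->
  {within H, continuous x} -> {within H, continuous y} ->
  (forall t, H t -> x t = picard tau z x t) ->
  (forall t, H t -> `|picard tau z y t - y t| <= a) ->
  forall t, H t -> `|x t - y t| <= 2 * a * w t1.
Proof.
move=> mtau cx cy xE ya.
pose S := [set `|x t - y t| / w t | t in H].
have H0 : H 0 by apply/horizonP; rewrite lexx ltW.
have [D D0 xyD] := continuous_norm_bounded (within_continuousB cx cy).
have w0 s : 0 < w s by exact: expR_gt0.
have ubS : has_ubound S.
  exists D => _ [t Ht <-]; rewrite ler_pdivrMr// (le_trans (xyD t Ht))//.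
  by rewrite ler_peMr// weight_ge1.
have S0 : S !=set0 by exists (`|x 0 - y 0| / w 0), 0.
have xyS t : H t -> `|x t - y t| <= sup S * w t.
  by move=> Ht; rewrite -ler_pdivrMr//; apply: ub_le_sup => //; exists t.
have a0 : 0 <= a by have := ya 0 H0; apply: le_trans.
have arith (c v b1 b2 : R) : 1 <= v -> 0 <= c -> b1 <= c * (v - 1) / 2 -> b2 <= a ->
    b1 + b2 <= (a + c / 2) * v.
  by move=> v1 c0 b1_ b2_; have := mulr_ge0 a0 (_ : 0 <= v - 1); rewrite subr_ge0 => /(_ v1); lra.
have half (c : R) : c <= a + c / 2 -> c <= 2 * a by lra.
have S_ge0 : 0 <= sup S.
  have S1 : S (`|x 0 - y 0| / w 0) by exists 0.
  by apply: le_trans (ub_le_sup ubS S1); rewrite divr_ge0// ltW.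
have Sle : sup S <= a + sup S / 2.
  apply: ge_sup => // _ [t Ht <-]; rewrite ler_pdivrMr//.
  apply: (@le_trans _ _ (`|x t - picard tau z y t| + `|picard tau z y t - y t|)).
    exact: ler_distD.
  apply: arith (ya t Ht) => //; first exact: weight_ge1.
  by rewrite {1}xE//; exact: picard_contraction.
have S2a : sup S <= 2 * a by exact: half Sle.
move=> t Ht; apply: (le_trans (xyS t Ht)); apply: ler_pM => //.
exact: weight_le.
Qed.

(** The limit trajectory almost solves the state equation of the k-th control:
    the defect is the difference of the initial states plus that of the integrals
    in [velocity_integral_cvg]. *)
Theorem trajectory_cvg (x_ : nat -> R -> 'rV[R]_n) x (z_ : nat -> 'rV[R]_n) z e :
  (forall k, is_trajectory t1 f (sigma_ k) (z_ k) (x_ k)) ->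
  is_trajectory t1 f sigma z x ->
  z_ @ F --> z -> 0 < e ->
  \forall k \near F, forall t, H t -> `|x_ k t - x t| <= e.
Proof.
move=> tx_ tx zz e0; pose d := e / (4 * w t1).
have w0 : 0 < w t1 by exact: expR_gt0.
have d0 : 0 < d by rewrite divr_gt0// mulr_gt0.
have cx : {within H, continuous x} by case: tx.
move/(@cvgrPdist_le _ _ _ F)/(_ _ d0) : zz => zz.
have vv := velocity_integral_cvg cx d0.
apply: (@filterS2 _ F _ _ _ _ _ zz vv) => k zk vk t Ht.
have -> : e = 2 * (2 * d) * w t1 by rewrite /d; field; rewrite gt_eqF.
have cxk : {within H, continuous (x_ k)} by case: (tx_ k).
apply: (weighted_gronwall (sigma__measurable k) cxk cx (trajectory_picard (tx_ k))) => // s Hs.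
apply: normr_rV_le; first by rewrite mulr_ge0// ltW.
move=> i; rewrite [x s](trajectory_picard tx Hs) !mxE opprD addrACA.
rewrite (le_trans (ler_normD _ _))// mulrDl mul1r lerD//; last exact: vk.
by rewrite distrC (le_trans _ zk)// -[leLHS](_ : `|(z - z_ k) ord0 i| = _) ?normr_coord_le// !mxE.
Qed.

End Stability.
End Trajectories.

(** * Charges dominated by Lebesgue measure *)

(** A cluster point in a compact interval is a limit, because an ultrafilter
    contains each set or its complement. *)
Lemma ultra_bounded_cvg (R : realType) (T : Type) (F : set_system T) (u : T -> R) (M : R) :
  UltraFilter F -> (forall k, `|u k| <= M) -> cvg (u @ F).
Proof.
move=> FU uM; have FF : ProperFilter F by exact: ultra_proper.
have [l [_ Fl]] : `[- M, M]%classic `&` cluster (u @ F) !=set0.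
  have := @segment_compact R (- M) M; apply.
  apply: (@filterS _ F _ setT); last exact: filterT.
  by move=> k _; rewrite /= in_itv/= -ler_norml.
apply/cvg_ex; exists l => W Wl.
have [//|FnW] := in_ultra_setVsetC (u @^-1` W) FU.
have [y [nWy Wy]] := Fl (~` W) W FnW Wl.
by [].
Qed.

(** The value of nu on the tail of a disjoint union is at most M times the measure
    of that tail, which tends to 0 because m is finite. *)
Lemma dominated_semi_sigma_additive (R : realType) (d : measure_display)
    (T : measurableType d) (m : {measure set T -> \bar R}) (nu : set T -> R) (M : R) :
  (m setT < +oo)%E ->
  (forall A B, measurable A -> measurable B -> A `&` B = set0 ->
    nu (A `|` B) = nu A + nu B) ->
  (forall A, measurable A -> `|nu A| <= M * fine (m A)) ->
  semi_sigma_additive (EFin \o nu).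
Proof.
move=> mT nuU num S mS tS mUS.
have mfin A : measurable A -> m A \is a fin_num.
  move=> mA; rewrite ge0_fin_numE// (le_lt_trans _ mT)// le_measure// inE//.
have disjS n : \big[setU/set0]_(i < n) S i `&` S n = set0.
  apply/seteqP; split=> // t [+ Snt]; rewrite -bigcup_mkord => -[i /= ni Sit].
  by have := tS i n I I (ex_intro _ t (conj Sit Snt)); move: ni => /[swap] ->; rewrite ltnn.
pose V n := \big[setU/set0]_(i < n) S i.
have mV n : measurable (V n) by exact: bigsetU_measurable.
have nu0 : nu set0 = 0.
  by apply/eqP; rewrite -normr_le0 (le_trans (num _ measurable0))// measure0 mulr0.
have nuV n : \sum_(0 <= i < n) (EFin \o nu) (S i) = (nu (V n))%:E.
  elim: n => [|n IH]; first by rewrite big_nil /V big_ord0 nu0.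
  rewrite big_nat_recr//= IH -EFinD /V big_ord_recr/= -/(V n) nuU//; exact: disjS.
have VS n : V n `<=` \bigcup_i S i.
  by rewrite /V -bigcup_mkord; apply: bigcup_sub => i _; exact: bigcup_sup.
have gap n : `|nu (\bigcup_i S i) - nu (V n)| <=
    M * (fine (m (\bigcup_i S i)) - fine (m (V n))).
  have e : \bigcup_i S i = V n `|` (\bigcup_i S i `\` V n) by rewrite setDUK.
  have dj : V n `&` (\bigcup_i S i `\` V n) = set0 by rewrite setDE setICA setICr setI0.
  have mD : measurable (\bigcup_i S i `\` V n) by exact: measurableD.
  rewrite [in X in X - _]e nuU// addrAC subrr add0r (le_trans (num _ mD))//.
  rewrite [in leRHS]e measureU// fineD ?mfin// addrAC subrr add0r//.
rewrite (_ : (fun n => _) = EFin \o (nu \o V)); last by apply/funext => n; exact: nuV.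
apply: cvg_EFin; first by apply: nearW.
have mcvg : (fun n => fine (m (V n))) @ \oo --> fine (m (\bigcup_i S i)).
  have mV' n : (\sum_(0 <= i < n) m (S i) = m (V n))%E.
    elim: n => [|n IH]; first by rewrite big_nil /V big_ord0 measure0.
    by rewrite big_nat_recr//= IH /V big_ord_recr/= -/(V n) measureU//; exact: disjS.
  have := @measure_semi_sigma_additive _ _ _ m S mS tS mUS.
  rewrite (_ : (fun n => _) = m \o V); last by apply/funext => n; exact: mV'.
  by rewrite -(fineK (mfin _ mUS)) => /fine_cvg.
apply/cvgrPdist_le => e e0.
have : (fun n => M * (fine (m (\bigcup_i S i)) - fine (m (V n)))) @ \oo --> (0 : R).
  rewrite -[X in _ --> X](mulr0 M) -[X in M * X](subrr (fine (m (\bigcup_i S i)))).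
  by apply: cvgM; [exact: cvg_cst|apply: cvgB => //; exact: cvg_cst].
move=> /cvgrPdist_le/(_ e e0); apply: filterS => n.
by rewrite sub0r normrN => /(le_trans (ler_norm _)); exact: le_trans (gap n).
Qed.

Section Density.
Context {R : realType}.
Local Notation lambda := (@lebesgue_measure R).

(** The domination makes nu an absolutely continuous charge, with a density g by
    the Radon-Nikodym theorem. The difference quotients are those of the
    primitive of g, whose derivative is g almost everywhere by Lebesgue
    differentiation. *)
Lemma dominated_density (D : set R) (nu : set R -> R) (M : R) :
  measurable D -> (lambda D < +oo)%E ->
  (forall A B, measurable A -> measurable B -> A `&` B = set0 ->
    nu (A `|` B) = nu A + nu B) ->
  (forall A, measurable A -> `|nu A| <= M * fine (lambda (A `&` D))) ->
  exists g : R -> R, [/\ measurable_fun setT g,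
    forall A, measurable A -> nu A = \int[lambda]_(t in A) g t &
    {ae lambda, forall t,
      n.+1%:R * nu `]t, t + n.+1%:R^-1]%classic @[n --> \oo] --> g t}].
Proof.
move=> mD Dfin nuU num.
have mT : (mrestr lambda mD setT < +oo)%E by rewrite /mrestr setTI.
have nu_additive := dominated_semi_sigma_additive mT nuU num.
have nu0 : (EFin \o nu) set0 = 0%E.
  congr EFin; apply/eqP; rewrite -normr_le0 (le_trans (num _ measurable0))//.
  by rewrite set0I measure0 mulr0.
pose nuE : {charge set (measurableTypeR R) -> \bar R} := HB.pack (EFin \o nu)
  (isCharge.Build _ (measurableTypeR R) R (EFin \o nu) nu0 (fun _ _ => isT) nu_additive).
have nu_lambda : nuE `<< lambda.
  apply/null_content_dominatesP => A mA A0; congr EFin.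
  apply/eqP; rewrite -normr_le0 (le_trans (num _ mA))//.
  have -> : lambda (A `&` D) = 0%E; last by rewrite mulr0.
  by apply: (@subset_measure0 _ (measurableTypeR R) R lambda _ A) => //; exact: measurableI.
pose h := Radon_Nikodym nuE lambda.
pose g t := fine (h t).
have hE : h = EFin \o g.
  by apply/funext => t; rewrite /g/= fineK//; exact: Radon_Nikodym_fin_num.
have ih : lambda.-integrable setT (EFin \o g).
  by rewrite -hE; exact: Radon_Nikodym_integrable.
have mg : measurable_fun setT g by apply/measurable_EFinP; exact: measurable_int ih.
have nug A : measurable A -> nu A = \int[lambda]_(t in A) g t.
  move=> mA; have := Radon_Nikodym_integral nu_lambda mA.
  by rewrite /Rintegral -/h hE => <-.
exists g; split => //.
have igy (y : R) : lambda.-integrable `]-oo, y] (EFin \o g) by exact: integrableS ih.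
have locg : locally_integrable setT g by apply: open_integrable_locally => //; exact: openT.
have := FTC1Ny igy locg; apply: filterS; first exact: (ae_filter_ringOfSetsType lambda).
move=> t [dF F't].
pose G x := \int[lambda]_(s in `]-oo, x]) g s.
have : h^-1 *: (G (h + t) - G t) @[h --> 0^'] --> g t.
  have : derivable (G : R -> R^o) t 1 by exact: dF.
  move=> /cvg_ex[l Gl]; suff -> : g t = l.
    by under eq_fun do rewrite -[X in X + t]mulr1.
  by rewrite -F't derive1E; apply/cvg_lim => //; exact: Rhausdorff.
move=> quot.
move/cvgr_dnbhsP : quot => /(_ (@harmonic R)).
have harmonic0 : (forall n, @harmonic R n != 0) /\ @harmonic R @ \oo --> (0 : R).
  by split; [move=> n; rewrite invr_eq0 pnatr_eq0|exact: cvg_harmonic].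
move=> /(_ harmonic0); apply: cvg_trans; apply: near_eq_cvg; apply: nearW => n /=.
have gap (a : R) : 0 < a -> G (a + t) - G t = nu `]t, t + a]%classic.
  move=> a0; rewrite /G -!nug// addrC addrC.
  have -> : `]-oo, a + t]%classic = `]-oo, t]%classic `|` `]t, t + a]%classic.
    by rewrite addrC; apply: itv_bndbnd_setU; rewrite bnd_simp// lerDl ltW.
  rewrite nuU//; first by rewrite addrC addKr.
  apply/seteqP; split => // s [/=]; rewrite !in_itv/= => st /andP[ts _].
  by have := lt_le_trans ts st; rewrite ltxx.
by rewrite /harmonic invrK gap// invr_gt0.
Qed.

End Density.

(** * Compactness of the relaxed controls *)

Section Compactness.
Context {R : realType} {p : nat} (t1 : R) (U : set 'rV[R]_p).
Local Notation H := (horizon t1).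
Local Notation C phi := {within U, continuous phi}.
Local Notation lambda := (@lebesgue_measure R).
Hypothesis t1_gt0 : 0 < t1.
Hypothesis U_compact : compact U.
Context (F : set_system nat) (F_ultra : UltraFilter F) (F_oo : \oo `<=` F).
Context (sigma_ : nat -> R -> PU U).
Hypothesis sigma__measurable : forall k, relaxed_controls t1 (sigma_ k).
Implicit Types (phi psi : 'rV[R]_p -> R) (A : set R).

Let FF : ProperFilter F. Proof. exact: ultra_proper. Qed.

Let mH : measurable (H : set (lebesgueR R)) := measurable_horizon t1.

Let partial phi A k : R := \int[leb R]_(t in H `&` A) avg (sigma_ k t) phi.

Definition limit_charge phi A : R := lim (partial phi A k @[k --> F]).

Let mHA A : measurable A -> measurable (H `&` A : set (lebesgueR R)).
Proof. by move=> mA; apply: measurableI => //; exact: measurable_lebesgueR. Qed.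

Let HA_lty A : measurable A -> (leb R (H `&` A) < +oo)%E.
Proof.
move=> mA; apply: le_lt_trans (leb_horizon_lty t1).
by apply: le_measure; rewrite ?inE//; exact: mHA.
Qed.

Let m_avg phi A k : C phi -> measurable A ->
  measurable_fun (H `&` A : set (lebesgueR R)) (fun t : lebesgueR R => avg (sigma_ k t) phi).
Proof.
move=> cphi mA; apply: (measurable_funS mH (@subIsetl _ H A)).
exact: measurable_avg.
Qed.

Let int_avg phi A k : C phi -> measurable A ->
  (leb R).-integrable (H `&` A) (EFin \o (fun t => avg (sigma_ k t) phi)).
Proof.
move=> cphi mA; have [M phiM] := continuous_bounded U_compact cphi.
apply: (bounded_integrable (mu := leb R) (mHA mA) (HA_lty mA) (m_avg k cphi mA) (M := M)).
by move=> t _; exact: normr_avg_le.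
Qed.

Let partial_le phi M A k : C phi -> measurable A -> (forall u, U u -> `|phi u| <= M) ->
  `|partial phi A k| <= M * fine (lambda (A `&` H)).
Proof.
move=> cphi mA phiM; rewrite setIC.
apply: (normr_Rintegral_le (mu := leb R) (mHA mA) (HA_lty mA) (m_avg k cphi mA)).
by move=> t _; exact: normr_avg_le.
Qed.

Lemma limit_charge_cvg phi A : C phi -> measurable A ->
  partial phi A k @[k --> F] --> limit_charge phi A.
Proof.
move=> cphi mA; have [M phiM] := continuous_bounded U_compact cphi.
have : cvg (partial phi A k @[k --> F]).
  apply: (ultra_bounded_cvg (M := M * fine (lambda (A `&` H))) F_ultra) => k.
  exact: partial_le.
by [].
Qed.

Lemma limit_charge_eq phi A l : partial phi A k @[k --> F] --> l ->
  limit_charge phi A = l.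
Proof. by move=> h; apply/cvg_lim => //; exact: Rhausdorff. Qed.

Lemma limit_charge_le phi M A : C phi -> measurable A -> (forall u, U u -> `|phi u| <= M) ->
  `|limit_charge phi A| <= M * fine (lambda (A `&` H)).
Proof.
move=> cphi mA phiM; have /cvg_norm := limit_charge_cvg cphi mA.
by move=> /cvgr_to_le; apply; apply: nearW => k; exact: partial_le.
Qed.

Lemma limit_chargeU phi A B : C phi -> measurable A -> measurable B ->
  A `&` B = set0 -> limit_charge phi (A `|` B) = limit_charge phi A + limit_charge phi B.
Proof.
move=> cphi mA mB AB0; apply: limit_charge_eq.
rewrite (_ : partial phi (A `|` B) = fun k => partial phi A k + partial phi B k).
  by apply: cvgD; exact: limit_charge_cvg.
apply/funext => k; rewrite /partial setIUr.
apply: (Rintegral_setU (mu := leb R) (mHA mA) (mHA mB)).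
  by rewrite -setIUr; apply: int_avg => //; exact: measurableU.
by apply/disj_setPS => t [[_ At] [_ Bt]]; rewrite -AB0.
Qed.

Lemma limit_chargeD phi psi A : C phi -> C psi -> measurable A ->
  limit_charge (fun u => phi u + psi u) A = limit_charge phi A + limit_charge psi A.
Proof.
move=> cphi cpsi mA; apply: limit_charge_eq.
rewrite (_ : partial _ _ = fun k => partial phi A k + partial psi A k).
  by apply: cvgD; exact: limit_charge_cvg.
apply/funext => k; rewrite /partial.
rewrite -(RintegralD (mu := leb R) (mHA mA) (int_avg k cphi mA) (int_avg k cpsi mA)).
by apply: eq_Rintegral => t _; exact: avgD.
Qed.

Lemma limit_chargeZ c phi A : C phi -> measurable A ->
  limit_charge (fun u => c * phi u) A = c * limit_charge phi A.
Proof.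
move=> cphi mA; apply: limit_charge_eq.
rewrite (_ : partial _ _ = fun k => c * partial phi A k).
  by apply: cvgMr; exact: limit_charge_cvg.
apply/funext => k; rewrite /partial.
rewrite -(RintegralZl (mu := leb R) c (mHA mA) (int_avg k cphi mA)).
by apply: eq_Rintegral => t _; exact: avgZ.
Qed.

Lemma limit_charge_ge0 phi A : C phi -> measurable A -> (forall u, U u -> 0 <= phi u) ->
  0 <= limit_charge phi A.
Proof.
move=> cphi mA phi0; apply: (cvgr_to_ge (limit_charge_cvg cphi mA)).
apply: nearW => k; apply: Rintegral_ge0 => t _.
by apply: Rintegral_ge0 => u /=; exact: phi0.
Qed.

Lemma limit_charge1 A : measurable A ->
  limit_charge (fun=> 1) A = fine (lambda (H `&` A)).
Proof.
move=> mA; apply: limit_charge_eq.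
rewrite (_ : partial _ _ = fun=> fine (lambda (H `&` A))); first exact: cvg_cst.
apply/funext => k; rewrite /partial.
under eq_Rintegral do rewrite avg_cst//.
by rewrite (Rintegral_cst (leb R) (mHA mA)) mul1r.
Qed.

Definition right_cell (t : R) (n : nat) : set R := `]t, t + n.+1%:R^-1]%classic.

Let mcell t n : measurable (right_cell t n).
Proof. exact: measurable_itv. Qed.

Let lambda_cell t n : fine (lambda (right_cell t n `&` H)) <= n.+1%:R^-1.
Proof.
have le1 : (lambda (right_cell t n `&` H) <= (n.+1%:R^-1)%:E)%E.
  apply: (@le_trans _ _ (lambda (right_cell t n))).
    apply: le_measure; [rewrite inE|rewrite inE|exact: subIsetl].
      by apply: measurableI; exact: measurable_itv.
    exact: measurable_itv.
  rewrite /right_cell lebesgue_measure_itv/= lte_fin ltrDl invr_gt0 ltr0n/=.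
  by rewrite -EFinB addrAC subrr add0r.
by rewrite -lee_fin fineK// ge0_fin_numE// (le_lt_trans le1)// ltry.
Qed.

(** The limit of the difference quotients of the limit charge at t. Taken along
    the ultrafilter it exists for all t and phi, whereas the limit along the
    integers exists only for almost every t, depending on phi. *)
Definition density_functional (t : R) phi : R :=
  lim (n.+1%:R * limit_charge phi (right_cell t n) @[n --> F]).

Lemma density_functional_cvg t phi : C phi ->
  n.+1%:R * limit_charge phi (right_cell t n) @[n --> F] --> density_functional t phi.
Proof.
move=> cphi; have [M phiM] := continuous_bounded U_compact cphi.
have : cvg (n.+1%:R * limit_charge phi (right_cell t n) @[n --> F]).
  apply: (ultra_bounded_cvg (M := `|M|) F_ultra) => n.
  rewrite normrM ger0_norm// mulrC -ler_pdivlMr//.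
  apply: le_trans (limit_charge_le cphi (mcell t n) (M := `|M|) _) _.
    by move=> u Uu; rewrite (le_trans (phiM u Uu))// ler_norm.
  by rewrite ler_wpM2l// lambda_cell.
by [].
Qed.

Lemma density_functional_eq t phi l :
  n.+1%:R * limit_charge phi (right_cell t n) @[n --> F] --> l ->
  density_functional t phi = l.
Proof. by move=> h; apply/cvg_lim => //; exact: Rhausdorff. Qed.

(** The endpoint t1 is excluded: there the right cells leave the horizon and the
    functional vanishes, whereas for [t < t1] they are eventually inside it, which
    gives the normalization. *)
Lemma density_functional_positive t : 0 <= t < t1 ->
  positive_functional U (density_functional t).
Proof.
move=> /andP[t0 tt1]; split.
- move=> phi psi cphi cpsi; apply: density_functional_eq.
  under eq_fun do rewrite limit_chargeD// mulrDr.
  by apply: cvgD; exact: density_functional_cvg.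
- move=> c phi cphi; apply: density_functional_eq.
  under eq_fun do rewrite limit_chargeZ// mulrCA.
  by apply: cvgMr; exact: density_functional_cvg.
- move=> phi cphi phi0; have := @density_functional_cvg t phi cphi.
  move=> /cvgr_to_ge; apply.
  by apply: nearW => n; rewrite mulr_ge0// limit_charge_ge0.
- apply: density_functional_eq.
  apply: cvg_near_cst; apply: F_oo.
  have e0 : 0 < t1 - t by rewrite subr_gt0.
  near=> n; have nt : n.+1%:R^-1 < t1 - t.
    by near: n; exact: (near_infty_natSinv_lt (PosNum e0)).
  rewrite limit_charge1// setIidr; last first.
    move=> s; rewrite /right_cell/= in_itv/= => /andP[ts st]; apply/horizonP.
    rewrite (le_trans t0 (ltW ts))/= (le_trans st)//.
    by rewrite -lerBrDl ltW.
  rewrite /right_cell lebesgue_measure_itv/= lte_fin ltrDl invr_gt0 ltr0n/=.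
  by rewrite addrAC subrr add0r mulfV// pnatr_eq0.
Unshelve. all: by end_near. Qed.

(** The limit control at t represents [density_functional t]. Its averages agree
    almost everywhere with the density of the limit charge, for each phi, which
    makes them measurable for the complete sigma-algebra and identifies their
    integrals over Borel sets with the limit charge. *)
Theorem relaxed_controls_ultra_limit :
  exists sigma : R -> PU U, relaxed_controls t1 sigma /\ control_cvg t1 F sigma_ sigma.
Proof.
(* at t1, a single time, any probability measure will do *)
pose c t := if 0 <= t < t1 then t else 0.
have c_in t : 0 <= c t < t1 by rewrite /c; case: ifPn => // _; rewrite lexx.
have /choice[sigma sigmaE] t : exists P : PU U,
    forall phi, C phi -> avg P phi = density_functional (c t) phi.
  exact: riesz_representation (density_functional_positive (c_in t)) U_compact.
have mHb : measurable (H : set R) by exact: measurable_itv.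
have H_lty : (lambda H < +oo)%E by exact: leb_horizon_lty.
have dens phi : C phi -> exists g : R -> R, [/\ measurable_fun setT g,
    forall A, measurable A -> limit_charge phi A = \int[lambda]_(t in A) g t &
    ae_eq (leb R) H (EFin \o g) (fun t => (avg (sigma t) phi)%:E)].
  move=> cphi; have [M phiM] := continuous_bounded U_compact cphi.
  have [g [mg nug dg]] := dominated_density mHb H_lty
    (fun A B mA mB => limit_chargeU cphi mA mB)
    (fun A mA => limit_charge_le cphi mA phiM).
  exists g; split => //.
  case: dg => N [mN N0 dN].
  exists (N `|` [set t1]); split.
  - by apply: measurable_lebesgueR; apply: measurableU.
  - rewrite [LHS](_ : _ = lambda (N `|` [set t1]))//.
    apply/eqP; rewrite -measure_le0 (le_trans (measureU2 _ _ _))//.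
    by rewrite [X in (X + _)%E]N0 [X in (_ + X)%E](lebesgue_measure_set1 t1) adde0.
  - move=> t /=; apply: contra_notP => /not_orP[nNt tt1] Ht.
    have {}nNt : n.+1%:R * limit_charge phi (right_cell t n) @[n --> \oo] --> g t.
      by apply: contrapT => h; apply: nNt; apply: dN.
    congr EFin; rewrite sigmaE//; apply/esym.
    have -> : c t = t.
      rewrite /c; case: ifPn => //; have /horizonP/andP[-> t_le] := Ht.
      by rewrite /= lt_neqAle t_le andbT => /negPn/eqP.
    apply: density_functional_eq.
    by apply: cvg_trans nNt; exact: cvg_app.
have msigma : relaxed_controls t1 sigma.
  apply: (relaxed_controls_avg U_compact) => phi cphi.
  have [g [mg _ ae]] := dens phi cphi.
  apply/measurable_EFinP.
  apply: (ae_measurable_fun (@completed_lebesgue_measure_is_complete R) ae).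
  apply/measurable_EFinP; apply: measurable_fun_lebesgueR => //.
  exact: measurable_funTS.
exists sigma; split => // A phi mA cphi.
have [g [mg nug ae]] := dens phi cphi.
have mHA' : measurable (H `&` A) by exact: measurableI.
have -> : \int[leb R]_(t in H `&` A) avg (sigma t) phi = limit_charge phi (H `&` A).
  rewrite nug// -Rintegral_lebesgueR//; last exact: measurable_funTS.
  rewrite /Rintegral; congr fine.
  apply: (ae_eq_integral (mu := leb R) (EFin \o g) _ (mHA mA)).
  - apply/measurable_EFinP; apply: (measurable_funS mH (@subIsetl _ H A)).
    exact: measurable_avg.
  - apply/measurable_EFinP; apply: measurable_fun_lebesgueR => //.
    exact: measurable_funTS.
  - apply: ae_eq_sym; case: ae => N [mN N0 subN]; exists N; split => // t /= ne.
    by apply: subN => /= eH; apply: ne => -[Ht _]; exact: eH.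
have -> : limit_charge phi (H `&` A) = limit_charge phi A.
  by rewrite /limit_charge /partial setIA setIid.
exact: limit_charge_cvg.
Qed.

End Compactness.

(** * The control problem *)

Section WeakConvergence.
Context {R : realType} {p : nat} (t1 : R) (U : set 'rV[R]_p).
Hypothesis U_compact : compact U.
Hypothesis U_neq0 : U !=set0.
Local Notation H := (horizon t1).

(** The product [\1_A t * phi u] is an admissible integrand; U being nonempty,
    the supremum of its absolute value over U is [\1_A t] times a constant. *)
Lemma rweak_control_cvg (sigma_ : nat -> R -> PU U) (sigma : R -> PU U) :
  rweak_cvg t1 sigma_ sigma -> control_cvg t1 \oo sigma_ sigma.
Proof.
move=> cs A phi mA cphi.
have mH := measurable_horizon t1.
pose g (t : R) (u : 'rV[R]_p) := \1_A t * phi u.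
have mind : measurable_fun (H : set (lebesgueR R)) (\1_A : lebesgueR R -> R).
  by apply: measurable_indic; exact: measurable_lebesgueR.
have avgE (s : R -> PU U) :
    \int[leb R]_(t in H) avg (s t) (g t) = \int[leb R]_(t in H `&` A) avg (s t) phi.
  rewrite -Rintegral_indic_restr; apply: eq_Rintegral => t _.
  exact: avgZ.
have := cs g; rewrite avgE (_ : (fun k => _) = fun k =>
  \int[leb R]_(t in H `&` A) avg (sigma_ k t) phi); last first.
  by apply/funext => k; exact: avgE.
apply.
- move=> u Uu; apply: measurable_funM; first exact: mind.
  exact: measurable_cst.
- by move=> t Ht; exact: within_continuousZ.
have [M phiM] := continuous_bounded U_compact cphi.
have [u0 Uu0] := U_neq0.
pose S := ereal_sup [set `|phi u|%:E | u in U].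
have Sle : (S <= M%:E)%E by apply: ge_ereal_sup => _ [u Uu <-]; rewrite lee_fin phiM.
have Sge : (0 <= S)%E.
  by apply: (@le_trans _ _ `|phi u0|%:E); [rewrite lee_fin|apply: ereal_sup_ubound; exists u0].
have Sfin : S \is a fin_num by rewrite ge0_fin_numE// (le_lt_trans Sle)// ltry.
rewrite (@eq_integral _ (lebesgueR R) R (leb R) H
  (fun t => (fine S * (\1_A : R -> R) t)%:E)); last first.
  move=> t _; rewrite /g indicE; case: (t \in A).
    rewrite mulr1 fineK// /S; congr ereal_sup.
    by apply/seteqP; split => _ [u Uu <-]; exists u => //; rewrite mul1r.
  rewrite mulr0; apply/eqP; rewrite eq_le; apply/andP; split.
    by apply: ge_ereal_sup => _ [u Uu <-]; rewrite mul0r normr0.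
  by apply: ereal_sup_ubound; exists u0 => //; rewrite mul0r normr0.
have : (leb R).-integrable H (EFin \o (fun t => fine S * \1_A t)).
  apply: (bounded_integrable (mu := leb R) (M := fine S) mH (leb_horizon_lty t1)).
    by apply: measurable_funM; [exact: measurable_cst|exact: mind].
  move=> t _; rewrite indicE ger0_norm ?mulr_ge0 ?fine_ge0//.
  by rewrite ler_piMr ?fine_ge0//; case: (_ \in _).
move=> /(integrable_fin_num mH); rewrite fin_numE => /andP[_].
by rewrite -ltey.
Qed.

Lemma relaxed_controls_neq0 : exists sigma : R -> PU U, relaxed_controls t1 sigma.
Proof.
have [u0 Uu0] := U_neq0.
have pos : positive_functional U (fun phi : 'rV[R]_p -> R => phi u0).
  by split => // phi _; exact.
have [P _] := riesz_representation pos U_compact.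
exists (fun=> P) => B _; rewrite preimage_cst; case: ifP => _.
  by rewrite setIT; exact: measurable_horizon.
by rewrite setI0; exact: measurable0.
Qed.

End WeakConvergence.

Lemma sup_dist_le (R : realType) (T : Type) (S : set T) (a b : T -> R) (e : R) :
  S !=set0 -> has_ubound (a @` S) -> has_ubound (b @` S) ->
  (forall s, S s -> `|a s - b s| <= e) -> `|sup (a @` S) - sup (b @` S)| <= e.
Proof.
move=> [s0 Ss0] ua ub ab.
have half (c d : T -> R) : has_ubound (d @` S) ->
    (forall s, S s -> `|c s - d s| <= e) -> sup (c @` S) <= sup (d @` S) + e.
  move=> ud cd; apply: ge_sup; first by exists (c s0), s0.
  move=> _ [s Ss <-]; have ds : d s <= sup (d @` S) by apply: ub_le_sup => //; exists s.
  by have := cd s Ss; rewrite ler_norml => /andP[_]; lra.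
rewrite ler_norml lerNl opprB !lerBlDr addrC half//=; last first.
  by move=> s Ss; rewrite distrC ab.
by rewrite addrC half.
Qed.

Section ControlProblem.
Context {R : realType} {n p : nat} (t1 : R) (U : set 'rV[R]_p)
  (f : R -> 'rV[R]_n -> 'rV[R]_p -> 'rV[R]_n)
  (Lr : R -> 'rV[R]_n -> 'rV[R]_p -> R)
  (Lmx : R -> 'rV[R]_n -> R) (Psi : 'rV[R]_n -> R) (K Kr KL : R).
Local Notation H := (horizon t1).
Hypothesis t1_gt0 : 0 < t1.
Hypothesis U_compact : compact U.
Hypothesis U_neq0 : U !=set0.
Hypothesis K_gt0 : 0 < K.
Hypothesis f_time : forall x : R -> 'rV[R]_n, {within H, continuous x} ->
  forall i, time_continuous t1 U (fun s u => f s (x s) u ord0 i).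
Hypothesis f_lip : forall s u z z' i, H s -> U u ->
  `|f s z u ord0 i - f s z' u ord0 i| <= K * `|z - z'|.
Hypothesis Lr_time : forall x : R -> 'rV[R]_n, {within H, continuous x} ->
  time_continuous t1 U (fun s => Lr s (x s)).
Hypothesis Lr_lip : forall s u z z', H s -> U u -> `|Lr s z u - Lr s z' u| <= Kr * `|z - z'|.
Hypothesis Kr_ge0 : 0 <= Kr.
Hypothesis Lmx_cont : {within [set z : R * 'rV[R]_n | H z.1], continuous (fun z => Lmx z.1 z.2)}.
Hypothesis Psi_cont : continuous Psi.
Hypothesis Lmx_lip : forall s z z', H s -> `|Lmx s z - Lmx s z'| <= KL * `|z - z'|.
Hypothesis KL_ge0 : 0 <= KL.
Implicit Types (z : 'rV[R]_n).

Lemma trajectoryP (sigma : R -> PU U) z : relaxed_controls t1 sigma ->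
  is_trajectory t1 f sigma z (trajectory t1 f sigma z).
Proof.
by move=> msigma; apply: xgetPex; apply: (trajectory_exists t1_gt0 U_compact K_gt0 f_time f_lip msigma).
Qed.

Lemma Lmx_trajectory_bounded (sigma : R -> PU U) z t : relaxed_controls t1 sigma ->
  H t -> has_ubound [set Lmx s (trajectory t1 f sigma z s) | s in horizon t].
Proof.
move=> msigma /horizonP/andP[_ tt1]; have [cx _] := trajectoryP z msigma.
have cL : {within H, continuous (fun s => Lmx s (trajectory t1 f sigma z s))}.
  apply: (within_continuous_comp (h := fun s => (s, trajectory t1 f sigma z s)) Lmx_cont) => //.
  apply: within_continuous_pair; last exact: cx.
  by apply: continuous_subspaceT => s; exact: cvg_id.
have cH : compact H by exact: segment_compact.
have /compact_bounded[M [_ LM]] := continuous_compact cL cH.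
exists (M + 1) => _ [s ts <-]; apply: le_trans (ler_norm _) _.
apply: LM; first by rewrite ltrDl.
by exists s => //; exact: horizon_sub tt1 _ ts.
Qed.

Section Convergence.
Context (F : set_system nat) {FF : ProperFilter F}.
Context (sigma_ : nat -> R -> PU U) (sigma : R -> PU U) (z_ : nat -> 'rV[R]_n) z.
Hypothesis sigma__measurable : forall k, relaxed_controls t1 (sigma_ k).
Hypothesis sigma_measurable : relaxed_controls t1 sigma.
Hypothesis sigma_cvg : control_cvg t1 F sigma_ sigma.
Hypothesis z_cvg : z_ @ F --> z.
Local Notation x_ k := (trajectory t1 f (sigma_ k) (z_ k)).
Local Notation x := (trajectory t1 f sigma z).

Lemma state_cvg e : 0 < e -> \forall k \near F, forall t, H t -> `|x_ k t - x t| <= e.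
Proof.
move=> e0; apply: (trajectory_cvg t1_gt0 U_compact K_gt0 f_time f_lip sigma__measurable
  sigma_measurable sigma_cvg _ (trajectoryP z sigma_measurable) z_cvg e0).
by move=> k; exact: trajectoryP.
Qed.

(** With the state frozen at the limit trajectory this is [control_cvg_time];
    the Lipschitz bound on the running cost and [state_cvg] absorb the change of
    state. *)
Lemma running_cost_cvg :
  running_cost t1 f Lr (sigma_ k) (z_ k) @[k --> F] --> running_cost t1 f Lr sigma z.
Proof.
have mH := measurable_horizon t1.
have [cx _] := trajectoryP z sigma_measurable.
have := control_cvg_time t1_gt0 U_compact sigma__measurable sigma_measurable
  sigma_cvg (Lr_time cx) (measurableT : measurable [set: R]).
rewrite setIT => /(_ FF) frozen.
apply/cvgrPdist_le => e e0; have e20 : 0 < e / 2 by rewrite divr_gt0.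
pose d := e / (2 * (Kr * t1 + 1)).
have c0 : 0 < Kr * t1 + 1 by rewrite ltr_wpDl// mulr_ge0// ltW.
have d0 : 0 < d by rewrite divr_gt0// mulr_gt0.
have dE : Kr * d * t1 <= e / 2.
  have : d * (2 * (Kr * t1 + 1)) = e by rewrite divfK// gt_eqF// mulr_gt0.
  by move: d0; lra.
have arith (a b c : R) : `|a - b| <= e / 2 -> `|c - b| <= e / 2 -> `|a - c| <= e.
  by rewrite !ler_norml => /andP[? ?] /andP[? ?]; apply/andP; split; lra.
move/cvgrPdist_le/(_ _ e20) : frozen => frozen.
have near_x := state_cvg d0.
apply: (@filterS2 _ F _ _ _ _ _ frozen near_x) => k fk xk.
apply: arith fk _.
have [cxk _] := trajectoryP (z_ k) (sigma__measurable k).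
have m1 := measurable_avg_time t1_gt0 U_compact (sigma__measurable k) (Lr_time cxk).
have m2 := measurable_avg_time t1_gt0 U_compact (sigma__measurable k) (Lr_time cx).
have [M1 _ b1] := avg_time_bounded t1_gt0 U_compact (sigma_ k) (Lr_time cxk).
have [M2 _ b2] := avg_time_bounded t1_gt0 U_compact (sigma_ k) (Lr_time cx).
rewrite /running_cost -(RintegralB (mu := leb R) mH
  (bounded_integrable_horizon m1 b1) (bounded_integrable_horizon m2 b2)).
apply: le_trans dE.
have -> : Kr * d * t1 = Kr * d * fine (leb R H) by rewrite leb_horizon// ltW.
apply: (normr_Rintegral_le (mu := leb R) mH (leb_horizon_lty t1)).
  exact: (measurable_funB m1 m2).
move=> t Ht; apply: (normr_avgB_le U_compact).
- exact: time_continuous_at (Lr_time cxk) _ Ht.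
- exact: time_continuous_at (Lr_time cx) _ Ht.
- by move=> u Uu; rewrite (le_trans (Lr_lip _ _ Ht Uu))// ler_wpM2l// xk.
Qed.

Lemma max_trajectory_cvg e : 0 < e -> \forall k \near F, forall t, H t ->
  `|max_trajectory t1 f Lmx (sigma_ k) (z_ k) t - max_trajectory t1 f Lmx sigma z t| <= e.
Proof.
move=> e0; pose d := e / (KL + 1).
have c0 : 0 < KL + 1 by rewrite ltr_wpDl.
have d0 : 0 < d by rewrite divr_gt0.
apply: filterS (state_cvg d0) => k xk t Ht.
have /horizonP/andP[t0 tt1] := Ht.
apply: sup_dist_le.
- by exists 0; apply/horizonP; rewrite lexx.
- exact: Lmx_trajectory_bounded.
- exact: Lmx_trajectory_bounded.
- move=> s /(horizon_sub tt1) Hs; apply: le_trans (Lmx_lip _ _ Hs) _.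
  apply: (@le_trans _ _ (KL * d)); first by rewrite ler_wpM2l// xk.
  by rewrite /d mulrA ler_pdivrMr// mulrC ler_wpM2l ?(ltW e0)// lerDl.
Qed.

Lemma supnorm_max_trajectory_cvg :
  supnorm t1 (fun t => max_trajectory t1 f Lmx (sigma_ k) (z_ k) t
    - max_trajectory t1 f Lmx sigma z t) @[k --> F] --> 0%E.
Proof.
have H0 : H 0 by apply/horizonP; rewrite lexx ltW.
pose N k := supnorm t1 (fun t => max_trajectory t1 f Lmx (sigma_ k) (z_ k) t
    - max_trajectory t1 f Lmx sigma z t).
have supnorm_ge0 (h : R -> R) : (0 <= supnorm t1 h)%E.
  by apply: (@le_trans _ _ `|h 0|%:E); [rewrite lee_fin|apply: ereal_sup_ubound; exists 0].
have N_ge0 k : (0 <= N k)%E by exact: supnorm_ge0.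
have N_le e : 0 < e -> \forall k \near F, (N k <= e%:E)%E.
  move=> /max_trajectory_cvg; apply: filterS => k yk.
  by apply: ge_ereal_sup => _ [t Ht <-]; rewrite lee_fin yk.
apply/fine_cvgP; split.
  apply: filterS (N_le 1 ltr01) => k Nk.
  by rewrite ge0_fin_numE ?N_ge0// (le_lt_trans Nk)// ltry.
apply/cvgrPdist_le => e e0; apply: filterS (N_le e e0) => k Nk.
rewrite sub0r normrN ger0_norm ?fine_ge0 ?N_ge0//.
rewrite -lee_fin fineK//.
by rewrite ge0_fin_numE ?N_ge0// (le_lt_trans Nk)// ltry.
Qed.

Lemma payoff_cvg :
  payoff t1 f Lr Lmx Psi (z_ k) (sigma_ k) @[k --> F] --> payoff t1 f Lr Lmx Psi z sigma.
Proof.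
have Ht1 : H t1 by apply/horizonP; rewrite lexx ltW.
apply: cvgB; first apply: cvgD.
- exact: running_cost_cvg.
- have : x_ k t1 @[k --> F] --> x t1.
    apply/cvgrPdist_le => e e0; apply: filterS (state_cvg e0) => k xk.
    by rewrite distrC; exact: xk t1 Ht1.
  by move=> /cvg_comp; apply; exact: Psi_cont.
- apply/cvgrPdist_le => e e0; apply: filterS (max_trajectory_cvg e0) => k yk.
  by rewrite distrC; exact: yk t1 Ht1.
Qed.

End Convergence.

(** The maximizing sequence has a limit control along a free ultrafilter, and
    the payoff is continuous along it. The levels [c k] are chosen so as not to
    require in advance that the supremum be finite. *)
Theorem optimal_control_exists z : exists sigma : R -> PU U,
  relaxed_controls t1 sigma /\
  forall tau : R -> PU U, relaxed_controls t1 tau ->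
    payoff t1 f Lr Lmx Psi z tau <= payoff t1 f Lr Lmx Psi z sigma.
Proof.
pose J (sigma : R -> PU U) := payoff t1 f Lr Lmx Psi z sigma.
pose S := ereal_sup [set (J sigma)%:E | sigma in relaxed_controls t1 (U := U)].
have [tau0 mtau0] := relaxed_controls_neq0 t1 U_compact U_neq0.
have S_ub (tau : R -> PU U) : relaxed_controls t1 tau -> ((J tau)%:E <= S)%E.
  by move=> mtau; apply: ereal_sup_ubound; exists tau.
pose c k : R := if S is +oo%E then k%:R else fine S - k.+1%:R^-1.
have S_gt : (-oo < S)%E by apply: lt_le_trans (S_ub _ mtau0); rewrite ltNyr.
have c_lt k : ((c k)%:E < S)%E.
  rewrite /c; case: (S) S_gt => [s _| _|//]; last by rewrite ltry.
  by rewrite lte_fin ltrBlDr ltrDl invr_gt0.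
have c_cvg (r : R) : (r%:E < S)%E -> \forall k \near \oo, r <= c k.
  rewrite /c; case: (S) => [s|_|//]; last exact: nbhs_infty_ger.
  rewrite lte_fin -subr_gt0 => rs; near=> k.
  rewrite lerBrDr -lerBrDl ltW//; near: k.
  exact: (near_infty_natSinv_lt (PosNum rs)).
have /choice[sigma_ sigmaP] k : exists sigma : R -> PU U,
    relaxed_controls t1 sigma /\ c k < J sigma.
  by have [_ [s ms <-]] := ereal_sup_gt (c_lt k); rewrite lte_fin => Js; exists s.
have m_ k : relaxed_controls t1 (sigma_ k) by have [] := sigmaP k.
have [F [F_ultra F_oo]] := @ultraFilterLemma nat \oo _.
have FF : ProperFilter F by exact: ultra_proper.
have [sigma [ms cs]] := relaxed_controls_ultra_limit t1_gt0 U_compact F_ultra F_oo m_.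
exists sigma; split; first exact: ms.
move=> tau mtau.
have Jcvg : J (sigma_ k) @[k --> F] --> J sigma.
  exact: (payoff_cvg m_ ms cs (cvg_cst z)).
rewrite leNgt; apply/negP => lt.
pose r := (J sigma + J tau) / 2.
have r1 : J sigma < r by rewrite midf_lt.
have r2 : (r%:E < S)%E.
  by apply: lt_le_trans (S_ub _ mtau); rewrite lte_fin midf_lt.
have : r <= J sigma.
  apply: (cvgr_to_ge Jcvg); apply: (@filterS _ F _ _ _ _ (F_oo _ (c_cvg r r2))) => k rk.
  by have [_ /ltW] := sigmaP k; exact: le_trans.
by rewrite leNgt r1.
Unshelve. all: by end_near. Qed.

End ControlProblem.

Theorem theorem2 (R : realType) (n p : nat) (t1 : R) (U : set 'rV[R]_p)
    (f : R -> 'rV[R]_n -> 'rV[R]_p -> 'rV[R]_n)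
    (Lr : R -> 'rV[R]_n -> 'rV[R]_p -> R)
    (Lmx : R -> 'rV[R]_n -> R) (Psi : 'rV[R]_n -> R)
    (t1_gt0 : 0 < t1)
    (U_neq0 : U !=set0)
    (* (A.0) *)
    (U_compact : compact U)
    (* (A.1) *)
    (f_cont : {within [set z : R * 'rV[R]_n * 'rV[R]_p |
                       horizon t1 z.1.1 /\ U z.2],
               continuous (fun z => f z.1.1 z.1.2 z.2)})
    (f_bound : exists Kf : R, 0 < Kf /\
       forall s u, horizon t1 s -> U u ->
         (forall x x', enorm (f s x u - f s x' u) <= Kf * enorm (x - x')) /\
         (forall x, enorm (f s x u) <= Kf * (1 + enorm x)))
    (* (A.2) *)
    (Lr_cont : {within [set z : R * 'rV[R]_n * 'rV[R]_p |
                        horizon t1 z.1.1 /\ U z.2],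
                continuous (fun z => Lr z.1.1 z.1.2 z.2)})
    (Lmx_cont : {within [set z : R * 'rV[R]_n | horizon t1 z.1],
                 continuous (fun z => Lmx z.1 z.2)})
    (Psi_cont : continuous Psi)
    (Lmx_lip : exists KL : R, forall s x x', horizon t1 s ->
       `|Lmx s x - Lmx s x'| <= KL * enorm (x - x'))
    (* (A.5) *)
    (Lr_bound : exists Kr : R, 0 < Kr /\
       forall s u, horizon t1 s -> U u ->
         (forall x x', `|Lr s x u - Lr s x' u| <= Kr * enorm (x - x')) /\
         (forall x, `|Lr s x u| <= Kr * (1 + enorm x))) :
  (* (a) *)
  (forall (I : set 'rV[R]_n) (x0_ : nat -> 'rV[R]_n) (x0 : 'rV[R]_n)
      (sigma_ : nat -> R -> PU U) (sigma : R -> PU U),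
      compact I -> (forall k, I (x0_ k)) -> I x0 ->
      x0_ @ \oo --> x0 ->
      (forall k, relaxed_controls t1 (sigma_ k)) ->
      relaxed_controls t1 sigma ->
      rweak_cvg t1 sigma_ sigma ->
      (fun k => running_cost t1 f Lr (sigma_ k) (x0_ k)) @ \oo -->
        running_cost t1 f Lr sigma x0
      /\
      (fun k => supnorm t1 (fun t =>
         max_trajectory t1 f Lmx (sigma_ k) (x0_ k) t
         - max_trajectory t1 f Lmx sigma x0 t)) @ \oo --> 0%E)
  /\
  (* (b) *)
  (forall x0 : 'rV[R]_n,
     exists sigma_star : R -> PU U,
       relaxed_controls t1 sigma_star /\
       (payoff t1 f Lr Lmx Psi x0 sigma_star)%:E =
         ereal_sup [set (payoff t1 f Lr Lmx Psi x0 sigma)%:E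
                   | sigma in relaxed_controls t1 (U := U)]).
Proof.
have [Kf [Kf0 fK]] := f_bound.
have [Kr0 [Kr00 LrK]] := Lr_bound.
have [KL LmxK] := Lmx_lip.
pose c : R := Num.sqrt n%:R.
have c0 : 0 <= c by exact: sqrtr_ge0.
(* the summand 1 keeps K positive in dimension 0, where c = 0 *)
pose K := Kf * c + 1.
have K0 : 0 < K by rewrite ltr_wpDl// mulr_ge0// ltW.
have f_time (x : R -> 'rV[R]_n) : {within horizon t1, continuous x} ->
    forall i, time_continuous t1 U (fun s u => f s (x s) u ord0 i).
  move=> cx i; apply: (joint_time_continuous U_compact
    (F := fun s z u => f s z u ord0 i) _ cx).
  apply: (within_continuous_comp (D := setT) (F := fun v : 'rV[R]_n => v ord0 i) _ f_cont) => //.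
  by apply: continuous_subspaceT; exact: coord_continuous.
have f_lip s u z z' i : horizon t1 s -> U u ->
    `|f s z u ord0 i - f s z' u ord0 i| <= K * `|z - z'|.
  move=> Hs Uu; have [fl _] := fK s u Hs Uu.
  have -> : f s z u ord0 i - f s z' u ord0 i = (f s z u - f s z' u) ord0 i by rewrite !mxE.
  rewrite (le_trans (enorm_ge_coord _ _))// (le_trans (fl z z'))//.
  apply: (@le_trans _ _ (Kf * (c * `|z - z'|))).
    by rewrite ler_wpM2l ?(ltW Kf0)// enorm_le_norm.
  by rewrite mulrA ler_wpM2r// lerDl.
have Lr_time (x : R -> 'rV[R]_n) : {within horizon t1, continuous x} ->
    time_continuous t1 U (fun s => Lr s (x s)).
  by move=> cx; exact: (joint_time_continuous U_compact Lr_cont cx).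
have Lr_lip s u z z' : horizon t1 s -> U u -> `|Lr s z u - Lr s z' u| <= Kr0 * c * `|z - z'|.
  move=> Hs Uu; have [Ll _] := LrK s u Hs Uu.
  by rewrite (le_trans (Ll z z'))// -mulrA ler_wpM2l ?(ltW Kr00)// enorm_le_norm.
have Krc0 : 0 <= Kr0 * c by rewrite mulr_ge0// ltW.
have Lmx_lip' s z z' : horizon t1 s -> `|Lmx s z - Lmx s z'| <= `|KL| * c * `|z - z'|.
  move=> Hs; rewrite (le_trans (LmxK s z z' Hs))// -mulrA.
  apply: (@le_trans _ _ (`|KL| * enorm (z - z'))).
    by rewrite ler_wpM2r ?ler_norm// sqrtr_ge0.
  by rewrite ler_wpM2l// enorm_le_norm.
have KLc0 : 0 <= `|KL| * c by rewrite mulr_ge0.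
split.
  move=> I x0_ x0 sigma_ sigma _ _ _ x0_cvg m_ ms rw.
  have cs := rweak_control_cvg U_compact U_neq0 rw.
  split.
    exact: (running_cost_cvg t1_gt0 U_compact K0 f_time f_lip Lr_time Lr_lip Krc0 m_ ms cs x0_cvg).
  exact: (supnorm_max_trajectory_cvg t1_gt0 U_compact K0 f_time f_lip Lmx_cont Lmx_lip' KLc0 m_ ms cs x0_cvg).
move=> x0.
have [sigma [ms opt]] := optimal_control_exists t1_gt0 U_compact U_neq0 K0 f_time f_lip
  Lr_time Lr_lip Krc0 Lmx_cont Psi_cont Lmx_lip' KLc0 x0.
exists sigma; split; first exact: ms.
apply/eqP; rewrite eq_le; apply/andP; split.
  by apply: ereal_sup_ubound; exists sigma.
by apply: ge_ereal_sup => _ [tau mtau <-]; rewrite lee_fin; exact: opt.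
Qed.
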